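(* Let $\mathfrak g$ be a real finite-dimensional semisimple Lie algebra with corresponding $1$-connected Lie group $G$, and let $\mathcal O\subset\mathfrak g^{*}$ be an orbit of the coadjoint representation of $G$. Let $P(\mathcal O)$ be the Poisson algebra of polynomial functions on $\mathcal O$, and let $P(\mathcal O)'=\{P(\mathcal O),P(\mathcal O)\}$ be its derived ideal. Then $$P(\mathcal O)=\mathbb R\oplus P(\mathcal O)'$$ as a direct sum of vector spaces, where $\mathbb R$ denotes the constant functions on $\mathcal O$.
   Context: The symmetric algebra $S(\mathfrak g)$ is identified with the algebra of polynomial functions on the dual space $\mathfrak g^{*}$. It is a Poisson algebra: its bracket $\{\,,\}$ is determined by $\{\xi,\eta\}=[\xi,\eta]$ for $\xi,\eta\in\mathfrak g$ and extended to all of $S(\mathfrak g)$ by the Leibniz rule (this is the restriction of the Lie-Poisson bracket on $C^\infty(\mathfrak g^* )$). For a coadjoint orbit $\mathcal O$, $I(\mathcal O)\subset S(\mathfrak g)$ denotes the ideal of polynomials vanishing on $\mathcal O$; it is a Poisson ideal (both an associative ideal and a Lie ideal). $P(\mathcal O)$ is the algebra of restrictions to $\mathcal O$ of polynomials on $\mathfrak g^*$, identified with $S(\mathfrak g)/I(\mathcal O)$, with the induced Poisson bracket. The derived ideal $P'=\{P,P\}$ of a Poisson algebra $P$ is the linear span of all brackets $\{f,g\}$ with $f,g\in P$. *)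

(* Defs.v *)
(* mpoly is imported without its notations, which clash with those of
   MathComp-Analysis. *)
From HB Require Import structures.
From mathcomp Require Import all_boot all_order all_algebra.
From mathcomp Require Import -(notations) mpoly.
From mathcomp Require Import ring.
From mathcomp Require Import all_classical all_reals all_analysis.

Set Implicit Arguments.
Unset Strict Implicit.
Unset Printing Implicit Defensive.

Import Order.TTheory GRing.Theory Num.Theory.
Import numFieldNormedType.Exports.

Local Open Scope classical_set_scope.
Local Open Scope ring_scope.

Section LieAlgebra.
Context {R : realType} {g : vectType R}.

Record is_lie_bracket (br : g -> g -> g) : Prop := {
  lie_linearl : forall y, linear (br^~ y) ;
  lie_linearr : forall x, linear (br x) ;
  lie_alt : forall x, br x x = 0 ;
  lie_jacobi : forall x y z,
    br x (br y z) + br y (br z x) + br z (br x y) = 0 }.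

Variable br : g -> g -> g.

Definition lie_ideal (I : {vspace g}) : Prop :=
  forall x y, y \in I -> br x y \in I.

(* For a bilinear br this is the span of all br u v with u in U, v in V. *)
Definition lie_comm (U V : {vspace g}) : {vspace g} :=
  <<[seq br u v | u <- vbasis U, v <- vbasis V]>>%VS.

Definition lie_derived (k : nat) (I : {vspace g}) : {vspace g} :=
  iter k (fun U => lie_comm U U) I.

Definition lie_solvable (I : {vspace g}) : Prop :=
  exists k, lie_derived k I = 0%VS.

Definition lie_semisimple : Prop :=
  forall I, lie_ideal I -> lie_solvable I -> I = 0%VS.

End LieAlgebra.

Section Smooth.
Context {R : realType}.

(* In finite dimension this is the usual class C^k on an open set U; values of
   f outside U are irrelevant. *)
Fixpoint Ck_on {V W : normedModType R} (k : nat) (U : set V) (f : V -> W) :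
    Prop :=
  match k with
  | 0%N => forall x, U x -> {for x, continuous f}
  | k'.+1 => (forall x, U x -> differentiable f x) /\
             (forall v, Ck_on k' U (fun x => 'd f x v))
  end.

Definition smooth_on {V W : normedModType R} (U : set V) (f : V -> W) : Prop :=
  forall k, Ck_on k U f.

(* A homeomorphism from the open set cdom onto an open subset of E; cmap and
   cinv are arbitrary outside of these sets. *)
Record chart (E : normedModType R) (M : topologicalType) := Chart {
  cdom : set M ;
  cmap : M -> E ;
  cinv : E -> M ;
  cdom_open : open cdom ;
  cran_open : open (cmap @` cdom) ;
  cmapK : forall x, cdom x -> cinv (cmap x) = x ;
  cmap_cont : forall x, cdom x -> {for x, continuous cmap} ;
  cinv_cont : forall y, (cmap @` cdom) y -> {for y, continuous cinv} }.

Definition smooth_map {E F : normedModType R} {M N : topologicalType}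
    (A : set (chart E M)) (B : set (chart F N)) (f : M -> N) : Prop :=
  continuous f /\
  forall c d, A c -> B d ->
    smooth_on (cmap c @` (cdom c `&` f @^-1` cdom d))
              (fun x => cmap d (f (cinv c x))).

Record smooth_atlas {E : normedModType R} {M : topologicalType}
    (A : set (chart E M)) : Prop := {
  atlas_cover : forall x, exists2 c, A c & cdom c x ;
  atlas_compat : smooth_map A A id ;
  atlas_hausdorff : hausdorff_space M ;
  atlas_second_countable : @second_countable M }.

Lemma open_prod {M N : topologicalType} (U : set M) (V : set N) :
  open U -> open V -> open (U `*` V).
Proof.
rewrite !openE => oU oV [x y] [/= Ux Vy].
by exists (U, V) => //; split; [exact: oU | exact: oV].
Qed.

Section ProductChart.
Context {E F : normedModType R} {M N : topologicalType}.
Variables (c : chart E M) (d : chart F N).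

Let pdom : set (M * N) := cdom c `*` cdom d.
Let pmap (z : M * N) : E * F := (cmap c z.1, cmap d z.2).
Let pinv (z : E * F) : M * N := (cinv c z.1, cinv d z.2).

Lemma chart_prod_image :
  pmap @` pdom = (cmap c @` cdom c) `*` (cmap d @` cdom d).
Proof.
apply/seteqP; split=> [_ [[x y] [/= cx dy] <-]|[_ _] [/= [x cx <-] [y dy <-]]].
  by split; [exists x | exists y].
by exists (x, y).
Qed.

Lemma chart_prod_dom_open : open pdom.
Proof. exact: open_prod (cdom_open c) (cdom_open d). Qed.

Lemma chart_prod_ran_open : open (pmap @` pdom).
Proof. by rewrite chart_prod_image; exact: open_prod (cran_open c) (cran_open d). Qed.

Lemma chart_prodK z : pdom z -> pinv (pmap z) = z.
Proof. by case: z => x y [/= cx dy]; rewrite /pinv /= !cmapK. Qed.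

Lemma chart_prod_map_cont z : pdom z -> {for z, continuous pmap}.
Proof.
case: z => x y [/= cx dy]; apply: cvg_pair => /=.
  by apply: (cvg_comp _ _ cvg_fst); exact: cmap_cont.
by apply: (cvg_comp _ _ cvg_snd); exact: cmap_cont.
Qed.

Lemma chart_prod_inv_cont z : (pmap @` pdom) z -> {for z, continuous pinv}.
Proof.
rewrite chart_prod_image; case: z => x y [/= cx dy]; apply: cvg_pair => /=.
  by apply: (cvg_comp _ _ cvg_fst); exact: cinv_cont.
by apply: (cvg_comp _ _ cvg_snd); exact: cinv_cont.
Qed.

Definition chart_prod : chart (E * F)%type (M * N)%type :=
  Chart chart_prod_dom_open chart_prod_ran_open chart_prodK
    chart_prod_map_cont chart_prod_inv_cont.

End ProductChart.

Definition atlas_prod {E F : normedModType R} {M N : topologicalType}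
    (A : set (chart E M)) (B : set (chart F N)) :
    set (chart (E * F)%type (M * N)%type) :=
  [set e | exists c d, [/\ A c, B d & e = chart_prod c d]].

End Smooth.

#[short(type="groupTopologicalType")]
HB.structure Definition GroupTopological := {G of Group G & Topological G}.

Section LieGroup.
Context {R : realType} {n : nat} {G : groupTopologicalType}.

Record lie_group (A : set (chart 'rV[R]_n G)) : Prop := {
  lie_group_atlas : smooth_atlas A ;
  lie_group_mul :
    smooth_map (atlas_prod A A) A (fun z : G * G => (z.1 * z.2)%g) ;
  lie_group_inv : smooth_map A A (fun a : G => (a^-1)%g) }.

(* A chart c around 1 identifies the tangent space T_1 G with 'rV[R]_n.
   The next two definitions are, through this identification, the adjoint
   representation Ad a = d(x |-> a x a^-1)_1 and the Lie bracket of T_1 G in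
   the form [X, Y] = ad X Y with ad = d(Ad)_1. *)
Definition tangent_Ad (c : chart 'rV[R]_n G) (a : G) : 'End('rV[R]_n) :=
  linfun ('d (fun x => cmap c (a * cinv c x * a^-1)%g) (cmap c 1%g)).

Definition tangent_bracket (c : chart 'rV[R]_n G) (X Y : 'rV[R]_n) :
    'rV[R]_n :=
  'd (fun x => tangent_Ad c (cinv c x) Y) (cmap c 1%g) X.

(* theta, read in the chart c, is an isomorphism from (g, br) to the Lie
   algebra of G. *)
Record lie_algebra_iso (g : vectType R) (br : g -> g -> g)
    (A : set (chart 'rV[R]_n G)) (c : chart 'rV[R]_n G)
    (theta : 'Hom(g, 'rV[R]_n)) : Prop := {
  lie_iso_chart : A c ;
  lie_iso_chart1 : cdom c 1%g ;
  lie_iso_bij : bijective theta ;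
  lie_iso_bracket : forall x y,
    theta (br x y) = tangent_bracket c (theta x) (theta y) }.

Definition Ad {g : vectType R} (c : chart 'rV[R]_n G)
    (theta : 'Hom(g, 'rV[R]_n)) (a : G) : 'End(g) :=
  (theta^-1 \o tangent_Ad c a \o theta)%VF.

Definition coAd {g : vectType R} (c : chart 'rV[R]_n G)
    (theta : 'Hom(g, 'rV[R]_n)) (a : G) (mu : 'Hom(g, R^o)) : 'Hom(g, R^o) :=
  (mu \o Ad c theta (a^-1)%g)%VF.

Definition coadjoint_orbit {g : vectType R} (c : chart 'rV[R]_n G)
    (theta : 'Hom(g, 'rV[R]_n)) (mu : 'Hom(g, R^o)) : set 'Hom(g, R^o) :=
  [set coAd c theta a mu | a in [set: G]].

End LieGroup.

Definition loops_contractible (R : realType) (T : topologicalType) : Prop :=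
  forall gamma : R -> T,
    {within `[0, 1], continuous gamma} -> gamma 0 = gamma 1 ->
    exists H : R * R -> T,
      [/\ {within `[0, 1] `*` `[0, 1], continuous H},
          forall t, t \in `[0, 1] -> H (0, t) = gamma t,
          forall t, t \in `[0, 1] -> H (1, t) = gamma 0 &
          forall s, s \in `[0, 1] -> H (s, 0) = gamma 0 /\ H (s, 1) = gamma 0].

Definition one_connected (R : realType) (T : topologicalType) : Prop :=
  connected [set: T] /\ loops_contractible R T.

Definition linear_span {R : realType} {V : lmodType R} (X : set V) : set V :=
  [set v | exists m (a : 'I_m -> R) (x : 'I_m -> V),
     (forall i, X (x i)) /\ v = \sum_i a i *: x i].

Section Poisson.
Context {R : realType} {g : vectType R}.

(* The symmetric algebra S(g), as the polynomial algebra on the basis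
   vbasis {:g} of g. *)
Definition sym_alg := mpoly (\dim {:g}) R.

Definition sym_inj (x : g) : sym_alg :=
  \sum_i coord (vbasis {:g}) i x *: mpolyX R (mnm1 i).

Definition sym_eval (mu : 'Hom(g, R^o)) (p : sym_alg) : R :=
  @meval _ R (fun i => mu (vbasis {:g})`_i) p.

Variable br : g -> g -> g.

(* The expression in coordinates of the biderivation extending br; see
   lie_poisson_inj and lie_poissonMl/r. *)
Definition lie_poisson (p q : sym_alg) : sym_alg :=
  \sum_i \sum_j mderiv i p * mderiv j q *
    sym_inj (br (vbasis {:g})`_i (vbasis {:g})`_j).

Lemma sym_eval_inj (mu : 'Hom(g, R^o)) x : sym_eval mu (sym_inj x) = mu x.
Proof.
rewrite /sym_eval /sym_inj raddf_sum [in RHS](coord_vbasis (memvf x)) linear_sum.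
by apply: eq_bigr => i _; rewrite linearZ /= mevalZ mevalXU.
Qed.

Lemma mderiv_sym_inj i x :
  mderiv i (sym_inj x) = mpolyC _ (coord (vbasis {:g}) i x).
Proof.
rewrite /sym_inj raddf_sum (bigD1 i) //= big1 => [|j ji].
  rewrite addr0 mderivZ mderivX mnm1E eqxx scale1r.
  have -> : mnm_sub (mnm1 i) (mnm1 i) = mnm0.
    by apply/mnmP=> k; rewrite mnmBE subnn mnm0E.
  by rewrite mpolyX0 -mul_mpolyC mulr1.
by rewrite mderivZ mderivX mnm1E (negbTE ji) scale0r scaler0.
Qed.

Lemma sym_inj_linear : linear sym_inj.
Proof.
move=> a x y; rewrite /sym_inj scaler_sumr -big_split; apply: eq_bigr => i _ /=.
by rewrite linearP scalerDl scalerA.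
Qed.

Lemma lie_poisson_inj x y : is_lie_bracket br ->
  lie_poisson (sym_inj x) (sym_inj y) = sym_inj (br x y).
Proof.
move=> [linl linr _ _]; set e := vbasis {:g}.
have lin_sum (V : lmodType R) (f : g -> V) (lf : linear f) (k : nat) c (v : 'I_k -> g) :
    f (\sum_i c i *: v i) = \sum_i c i *: f (v i).
  elim/big_rec2: _ => [|i _ u _ <-]; last exact: lf.
  by have := lf (-1) 0 0; rewrite scaler0 addr0 scaleN1r addNr.
rewrite [in RHS](coord_vbasis (memvf x)) (lin_sum _ _ (linl y)).
rewrite (lin_sum _ _ sym_inj_linear); apply: eq_bigr => i _.
rewrite [in RHS](coord_vbasis (memvf y)) (lin_sum _ _ (linr _)).
rewrite (lin_sum _ _ sym_inj_linear) scaler_sumr; apply: eq_bigr => j _.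
by rewrite !mderiv_sym_inj -mulrA !mul_mpolyC.
Qed.

Lemma lie_poissonMl p q r :
  lie_poisson (p * q) r = p * lie_poisson q r + lie_poisson p r * q.
Proof.
rewrite /lie_poisson mulr_sumr mulr_suml -big_split; apply: eq_bigr => i _ /=.
rewrite mulr_sumr mulr_suml -big_split; apply: eq_bigr => j _ /=.
rewrite mderivM; ring.
Qed.

Lemma lie_poissonMr p q r :
  lie_poisson r (p * q) = p * lie_poisson r q + lie_poisson r p * q.
Proof.
rewrite /lie_poisson mulr_sumr mulr_suml -big_split; apply: eq_bigr => i _ /=.
rewrite mulr_sumr mulr_suml -big_split; apply: eq_bigr => j _ /=.
rewrite mderivM; ring.
Qed.

Variable O : set 'Hom(g, R^o).

Definition sym_restr (p : sym_alg) : O -> R^o :=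
  fun mu => sym_eval (\val mu) p.

(* P(O); sym_restr induces its identification with S(g)/I(O). *)
Definition poly_on : set (O -> R^o) := range sym_restr.

(* The bracket {f, h} = k induced on P(O), as a relation: the bracket of the
   classes of p and q modulo I(O) is the class of lie_poisson p q. *)
Definition orbit_bracket (f h k : O -> R^o) : Prop :=
  exists p q, [/\ f = sym_restr p, h = sym_restr q &
                  k = sym_restr (lie_poisson p q)].

Definition derived_ideal : set (O -> R^o) :=
  linear_span [set k | exists f h,
    [/\ poly_on f, poly_on h & orbit_bracket f h k]].

Definition constants_on : set (O -> R^o) := range (fun a => cst a).

End Poisson.

Arguments sym_restr {R g} O p _.
Arguments poly_on {R g} O _.
Arguments orbit_bracket {R g} br O f h k.
Arguments derived_ideal {R g} br O _.
Arguments constants_on {R g} O _.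

(* Meant for linear subspaces P, A, B of V. *)
Definition internal_direct_sum {V : zmodType} (P A B : set V) : Prop :=
  P = [set a + b | a in A & b in B] /\ A `&` B = [set 0].

(* Main.v *)
Require Import Defs.
From HB Require Import structures.
From mathcomp Require Import all_boot all_order all_algebra.
From mathcomp Require Import spectral complex ring.
From mathcomp Require Import -(notations) mpoly.
From mathcomp Require Import all_classical all_reals all_analysis.

(* The Lie algebra g acts on S(g) by x.p = {x, p}, preserving the degree, and
   the bracket identity {p, q} = sum_i {e_i, (d_i p) q} gives {S(g), S(g)} =
   g.S(g).  For semisimple g every finite-dimensional representation V is the
   direct sum of its invariants V^g and of g.V: if the action is nontrivial, a
   Casimir operator C (built from the trace form, which Cartan's criterion
   makes nondegenerate) commutes with g and is not nilpotent, and the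
   Fitting decomposition of V for C reduces the statement to ker C^k, on which
   one argues by induction.  The components of v are obtained from v by
   operators in the associative algebra generated by g, so they belong to every
   subrepresentation containing v.

   Since G is connected, invariant polynomials are constant on O, whence
   P(O) = R + P(O)'.  The ideal I(O) is stable under g because O is stable
   under G; hence if the constant a equals an element of g.S(g) on O, then the
   invariant component of an element of I(O) is a and lies in I(O), so a = 0. *)

Set Implicit Arguments.
Unset Strict Implicit.
Unset Printing Implicit Defensive.

Import Order.TTheory GRing.Theory Num.Theory.
Import numFieldNormedType.Exports.
Local Open Scope classical_set_scope.
Local Open Scope ring_scope.

(** The ground field is R, and neither g nor its representations are complexified; only single
    matrices are. Instead of a Jordan decomposition, Cartan's criterion uses a real replica y of a
    matrix x: the real part of the matrix acting on each generalized eigenspace of x as the complex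
    conjugate of the eigenvalue. Then ad y is a polynomial in ad x, and tr(x y) is the sum of the
    squared moduli of the eigenvalues, so that tr(x y) = 0 forces x to be nilpotent. As the
    representation is not assumed irreducible, the Casimir operator is only known to commute with g
    and to have nonzero trace; hence the Fitting decomposition. S(g) is infinite-dimensional, but
    the polynomials below a given degree form a representation, on which I(O) is seen through a
    predicate. On the group side there is no exponential map and no flow: the bracket of T_1 G is by
    definition the differential of Ad at 1, and translations carry this information to the other
    points of G. *)

Lemma lin_map0 (K : pzRingType) (U V : lmodType K) (f : U -> V) : linear f -> f 0 = 0.
Proof. by move=> lf; have := lf (-1) 0 0; rewrite scaler0 addr0 scaleN1r addNr. Qed.

Lemma lin_mapZ (K : pzRingType) (U V : lmodType K) (f : U -> V) a u :
  linear f -> f (a *: u) = a *: f u.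
Proof. by move=> lf; rewrite -[a *: u]addr0 lf lin_map0 // addr0. Qed.

Lemma lin_mapD (K : pzRingType) (U V : lmodType K) (f : U -> V) u v :
  linear f -> f (u + v) = f u + f v.
Proof. by move=> lf; rewrite -[u]scale1r lf !scale1r. Qed.

Lemma lin_mapB (K : pzRingType) (U V : lmodType K) (f : U -> V) u v :
  linear f -> f (u - v) = f u - f v.
Proof. by move=> lf; rewrite addrC -scaleN1r lf scaleN1r addrC. Qed.

Lemma lin_map_sum (K : pzRingType) (U V : lmodType K) (f : U -> V)
    I (r : seq I) (P : pred I) F :
  linear f -> f (\sum_(i <- r | P i) F i) = \sum_(i <- r | P i) f (F i).
Proof.
move=> lf; elim/big_rec2: _ => [|i _ u _ <-]; first exact: lin_map0.
by rewrite lin_mapD.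
Qed.

(** * Replicas of matrices *)

Section PolyCRT.
Variable F : fieldType.
Implicit Types (s : seq F) (N : nat).

Lemma coprimep_XsubC_exp (a b : F) N : a != b ->
  coprimep (('X - a%:P) ^+ N) (('X - b%:P) ^+ N).
Proof.
move=> ab; rewrite coprimep_expl // coprimep_expr // coprimep_XsubC2 //.
by rewrite subr_eq0 eq_sym.
Qed.

Lemma coprimep_prod_XsubC_exp s b N : b \notin s ->
  coprimep (\prod_(a <- s) ('X - a%:P) ^+ N) (('X - b%:P) ^+ N).
Proof.
elim: s => [|a s IH]; first by rewrite big_nil coprime1p.
rewrite inE negb_or => /andP[ba bs]; rewrite big_cons coprimepMl IH // andbT.
by rewrite coprimep_XsubC_exp // eq_sym.
Qed.

Lemma prod_XsubC_exp_dvdp s N (H : {poly F}) : uniq s ->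
  {in s, forall a, ('X - a%:P) ^+ N %| H} ->
  \prod_(a <- s) ('X - a%:P) ^+ N %| H.
Proof.
elim: s => [|b s IH] /=; first by rewrite big_nil dvd1p.
move=> /andP[bs us] Hd; rewrite big_cons mulrC.
rewrite Gauss_dvdp ?coprimep_prod_XsubC_exp //; apply/andP; split.
  by apply: IH => // a ains; apply: Hd; rewrite inE ains orbT.
by apply: Hd; rewrite mem_head.
Qed.

(** Chinese remainder theorem by induction: a solution for [s] is corrected by a multiple of the
    product over [s] which, by Bezout, is congruent to 1 modulo the new factor. *)
Lemma poly_crt s N (phi : F -> F) : uniq s ->
  exists P : {poly F}, {in s, forall a, ('X - a%:P) ^+ N %| P - (phi a)%:P}.
Proof.
elim: s => [|b s IH] /=; first by exists 0.
move=> /andP[bs us]; have [P0 HP0] := IH us.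
have /Bezout_eq1_coprimepP [u Hu] := coprimep_prod_XsubC_exp N bs.
set m := \prod_(a <- s) _ in Hu.
exists (P0 + u.1 * m * ((phi b)%:P - P0)) => a; rewrite inE => /orP[/eqP->|ains].
  have -> : P0 + u.1 * m * ((phi b)%:P - P0) - (phi b)%:P =
     (P0 - (phi b)%:P) * u.2 * ('X - b%:P) ^+ N.
    have -> : u.1 * m = 1 - u.2 * ('X - b%:P) ^+ N by rewrite -Hu addrK.
    ring.
  by rewrite dvdp_mull.
rewrite addrAC dvdp_add ?HP0 // dvdp_mulr // dvdp_mull // /m (big_rem a) //=.
by rewrite dvdp_mulr.
Qed.

End PolyCRT.

Section PolyAction.
Variables (F : fieldType) (V : lmodType F).

(** The vector p(D) v. [D] is a bare function because it will be N |-> X N - N X on matrices, for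
    which no algebra of endomorphisms is then needed. *)
Definition poly_act (D : V -> V) (p : {poly F}) (v : V) : V :=
  \sum_(i < size p) p`_i *: iter i D v.

Lemma poly_actE D k (p : {poly F}) v : (size p <= k)%N ->
  poly_act D p v = \sum_(i < k) p`_i *: iter i D v.
Proof.
move=> hk; rewrite /poly_act (big_ord_widen _ (fun i => p`_i *: iter i D v) hk).
rewrite big_mkcond; apply: eq_bigr => i _; case: ltnP => // hi.
by rewrite nth_default // scale0r.
Qed.

Lemma poly_actD D p q v : poly_act D (p + q) v = poly_act D p v + poly_act D q v.
Proof.
rewrite (@poly_actE D (maxn (size p) (size q)) (p + q)) ?size_polyD //.
rewrite (@poly_actE D (maxn (size p) (size q)) p) ?leq_maxl //.
rewrite (@poly_actE D (maxn (size p) (size q)) q) ?leq_maxr // -big_split.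
by apply: eq_bigr => i _; rewrite coefD scalerDl.
Qed.

Lemma poly_actZ D c p v : poly_act D (c *: p) v = c *: poly_act D p v.
Proof.
rewrite (poly_actE _ _ (size_scale_leq _ _)) scaler_sumr.
by apply: eq_bigr => i _; rewrite coefZ scalerA.
Qed.

Lemma poly_actC D c v : poly_act D c%:P v = c *: v.
Proof.
by rewrite (poly_actE _ _ (size_polyC_leq1 _)) big_ord1 coefC eqxx.
Qed.

Lemma poly_actMX D p v : poly_act D (p * 'X) v = poly_act D p (D v).
Proof.
have h : (size (p * 'X)%R <= (size p).+1)%N.
  by have [->|p0] := eqVneq p 0; rewrite ?mul0r ?size_poly0 // size_mulX.
rewrite (poly_actE _ _ h) big_ord_recl coefMX scale0r add0r.
by apply: eq_bigr => i _; rewrite coefMX /= -iterSr.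
Qed.

Variable D : V -> V.
Hypothesis linD : linear D.

Lemma iter_lin i : linear (iter i D).
Proof. by elim: i => [|i IH] a u v //=; rewrite IH linD. Qed.

Lemma poly_act_lin p : linear (poly_act D p).
Proof.
move=> a u v; rewrite /poly_act scaler_sumr -big_split; apply: eq_bigr => i _ /=.
by rewrite iter_lin scalerDr !scalerA mulrC.
Qed.

Lemma poly_actXsubC_exp p c j v :
  poly_act D (p * ('X - c%:P) ^+ j) v = poly_act D p (iter j (fun w => D w - c *: w) v).
Proof.
elim: j v => [|j IH] v; first by rewrite mulr1.
have -> : p * ('X - c%:P) ^+ j.+1 =
    p * ('X - c%:P) ^+ j * 'X + (- c) *: (p * ('X - c%:P) ^+ j).
  by rewrite exprSr mulrA mulrBr -mul_polyC polyCN mulNr [c%:P * _]mulrC.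
rewrite poly_actD poly_actMX poly_actZ !IH iterSr.
have linE : linear (fun w => D w - c *: w).
  move=> a u w; rewrite linD scalerDr scalerBr !scalerA mulrC opprD !addrA.
  by congr (_ + _); rewrite addrAC.
have linI : linear (iter j (fun w => D w - c *: w)).
  by elim: j {IH} => [|i IH] a u w //=; rewrite IH linE.
rewrite addrC (addrC (D v)) -[in RHS]scaleNr linI poly_act_lin.
by [].
Qed.

Lemma poly_act_scalar (Q : {poly F}) c d j v :
  ('X - c%:P) ^+ j %| Q - d%:P -> iter j (fun w => D w - c *: w) v = 0 ->
  poly_act D Q v = d *: v.
Proof.
move=> /dvdpP [k Hk] Hv; rewrite -(subrK d%:P Q) Hk poly_actD poly_actC.
rewrite poly_actXsubC_exp Hv.
by rewrite (lin_map0 (poly_act_lin k)) add0r.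
Qed.

End PolyAction.

(** Left multiplication by A and right multiplication by B commute, so each term of the binomial
    expansion contains A^p M or M B^q. The induction on p + q replaces the expansion: A M and M B
    satisfy the hypotheses with p, respectively q, lowered by one. *)
Lemma iter_ad_nilp (K : pzRingType) m p q (A B M : 'M[K]_m) :
  A ^+ p *m M = 0 -> M *m B ^+ q = 0 ->
  iter (p + q) (fun N => A *m N - N *m B) M = 0.
Proof.
have itlin k : forall (u v : 'M[K]_m),
  iter k (fun N => A *m N - N *m B) (u - v) =
  iter k (fun N => A *m N - N *m B) u - iter k (fun N => A *m N - N *m B) v.
  by elim: k => [|k IH] u v //=; rewrite IH mulmxBr mulmxBl !opprD addrACA.
have it0 k : iter k (fun N => A *m N - N *m B) 0 = 0.
  by elim: k => [|k IH] //=; rewrite IH mulmx0 mul0mx subr0.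
have [k] := ubnP (p + q); elim: k => // k IH in p q M *.
case: p => [|p]; first by rewrite expr0 mul1mx => _ -> _; exact: it0.
case: q => [|q]; first by rewrite expr0 mulmx1 => _ _ ->; exact: it0.
rewrite addnS ltnS => hk hp hq.
have e1 : iter (p.+1 + q) (fun N => A *m N - N *m B) (M *m B) = 0.
  by apply: IH => //; rewrite ?mulmxA ?hp ?mul0mx // -mulmxA -[B *m _]exprS.
have e2 : iter (p + q.+1) (fun N => A *m N - N *m B) (A *m M) = 0.
  apply: IH; rewrite ?mulmxA //; first by rewrite addnS.
    by rewrite -[_ *m A]exprSr.
  by rewrite -mulmxA hq mulmx0.
by rewrite iterSr itlin e1 -addSnnS in e2 *; rewrite e2 subr0.
Qed.

Section Replica.

(** No root has multiplicity above the size n + 1, so the characteristic polynomial divides H and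
    Cayley-Hamilton applies. *)
Lemma horner_mx_eq0 (F : fieldType) n (X : 'M[F]_n.+1) (s : seq F) (H : {poly F}) :
  char_poly X = \prod_(z <- s) ('X - z%:P) ->
  {in s, forall a, ('X - a%:P) ^+ n.+1 %| H} -> horner_mx X H = 0.
Proof.
move=> Xs HH.
have sz : size s = n.+1.
  by have := size_char_poly X; rewrite Xs size_prod_XsubC => -[].
have dX : char_poly X %| H.
  apply: dvdp_trans (prod_XsubC_exp_dvdp (undup_uniq s) _); last first.
    by move=> a; rewrite mem_undup; exact: HH.
  rewrite Xs -prodr_undup_exp_count; elim/big_ind2: _ => //.
    by move=> *; exact: dvdp_mul.
  by move=> a _; rewrite dvdp_exp2l // -sz count_size.
by have /dvdpP [k ->] := dX; rewrite rmorphM /= Cayley_Hamilton mulr0.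
Qed.

Lemma mxtrace_horner_trig (F : fieldType) n (T : 'M[F]_n.+1) (p : {poly F}) :
  is_trig_mx T -> is_trig_mx (horner_mx T p) /\ forall i, horner_mx T p i i = p.[T i i].
Proof.
move=> tT; elim/poly_ind: p => [|p c [IHt IHd]].
  by rewrite rmorph0; split=> [|i]; [apply/is_trig_mxP => ? ? _|]; rewrite mxE ?horner0.
rewrite rmorphD rmorphM /= horner_mx_X horner_mx_C.
have h (i j : 'I_n.+1) : (i <= j)%N -> (horner_mx T p *m T) i j = horner_mx T p i j * T j j.
  move=> ij; rewrite mxE (bigD1 j) //= big1 ?addr0 // => k kj.
  case: (ltngtP k j) => [kj'|jk|/val_inj/eqP]; last by rewrite (negbTE kj).
    by rewrite (is_trig_mxP tT) ?mulr0.
  by rewrite (is_trig_mxP IHt) ?mul0r // (leq_ltn_trans ij).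
split=> [|i].
  apply/is_trig_mxP => i j ij; rewrite mxE h ?(ltnW ij) // (is_trig_mxP IHt) //.
  by rewrite mxE mul0r add0r -val_eqE ltn_eqF.
by rewrite mxE h // IHd [X in _ + X]mxE eqxx hornerMXaddC.
Qed.

(* P(X) acts as the scalar a^* on the generalized eigenspace of X for a, so
   that ad P(X) acts as a^* on that of ad X and is a polynomial in ad X, and
   tr(X P(X)) is the sum of the |a|^2. *)
Lemma replica_closed (C : numClosedFieldType) n (X : 'M[C]_n.+1) :
  exists P Q : {poly C},
    (forall M, horner_mx X P *m M - M *m horner_mx X P =
       poly_act (fun N => X *m N - N *m X) Q M) /\
    0 <= \tr (X *m horner_mx X P) /\
    (\tr (X *m horner_mx X P) = 0 -> X ^+ n.+1 = 0).
Proof.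
have [U Uu tT] := Schur X (ltn0Sn n).
have Uunit : U \in unitmx by rewrite unitarymx_unit.
have [T trT XT] : exists2 T, is_trig_mx T & X = invmx U *m T *m U.
  exists (conjmx U X); first exact: tT.
  by rewrite conjumx // !mulmxA mulVmx // mul1mx mulmxKV.
set s := [seq T i i | i <- enum 'I_n.+1].
have sP i : T i i \in s by apply/mapP; exists i; rewrite ?mem_enum.
have Xs : char_poly X = \prod_(z <- s) ('X - z%:P).
  have -> : char_poly X = char_poly T.
    rewrite /char_poly /char_poly_mx XT !map_mxM /=.
    set V := map_mx _ U; set W := map_mx _ (invmx U).
    have WV : W *m V = 1%:M by rewrite -map_mxM mulVmx // map_mx1.
    have XE : 'X%:M = W *m 'X%:M *m V :> 'M[{poly C}]_n.+1.
      by rewrite scalar_mxC -mulmxA WV mulmx1.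
    by rewrite {1}XE -mulmxBl -mulmxBr !det_mulmx mulrAC -det_mulmx WV det1 mul1r.
  by rewrite char_poly_trig // big_map big_enum.
have zero := horner_mx_eq0 Xs.
set r := undup s.
have ur : uniq r := undup_uniq s.
have rs a : (a \in s) = (a \in r) by rewrite mem_undup.
have [P HP] := poly_crt n.+1 (fun z : C => z^*) ur.
(* The eigenvalues of ad X are the differences a - b, and 2(n + 1) is the nilpotency exponent that
   [iter_ad_nilp] gives for ad X - (a - b). Since conjugation is additive, the value at a - b is a^*
   - b^*. *)
have [Q HQ] := poly_crt (n.+1 + n.+1) (fun z : C => z^*)
  (undup_uniq [seq a - b | a <- r, b <- r]).
(* At X, these polynomials become the projections [e a] onto the generalized eigenspaces of X. *)
have /choice [E HE] : forall a, exists P0 : {poly C},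
    {in r, forall b, ('X - b%:P) ^+ n.+1 %| P0 - ((b == a)%:R)%:P}.
  by move=> a; exact: (poly_crt n.+1 (fun b => (b == a)%:R) ur).
exists P, Q; split; last first.
  have [tP dP] := mxtrace_horner_trig P trT.
  have trE : \tr (X *m horner_mx X P) = \sum_i `|T i i| ^+ 2.
    rewrite XT horner_mx_uconjC //.
    rewrite -!mulmxA mulKVmx // mxtrace_mulC -!mulmxA mulmxV // mulmx1 /mxtrace.
    apply: eq_bigr => j _; rewrite mxE (bigD1 j) //= big1 => [|k kj].
      rewrite dP addr0 normCK; congr (_ * _).
      have /HP : T j j \in r by rewrite -rs.
      rewrite exprS => /(dvdp_trans (dvdp_mulr _ (dvdpp _))).
      by rewrite dvdp_XsubCl /root !hornerE subr_eq0 => /eqP ->.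
    case: (ltngtP k j) => [kj'|jk|/val_inj/eqP]; last by rewrite (negbTE kj).
      by rewrite (is_trig_mxP tP) ?mulr0.
    by rewrite (is_trig_mxP trT) ?mul0r.
  rewrite trE; split; first by apply: sumr_ge0 => i _; exact: exprn_ge0.
  move=> tr0; have Ti0 i : T i i = 0.
    move/eqP: tr0; rewrite psumr_eq0 => [/allP /(_ i)|j _]; last exact: exprn_ge0.
    by rewrite mem_index_enum sqrf_eq0 normr_eq0 => /(_ isT)/eqP.
  rewrite -(Cayley_Hamilton X) Xs big_map big_enum /=.
  rewrite (eq_bigr (fun=> 'X)) => [|i _]; last by rewrite Ti0 subr0.
  by rewrite prodr_const card_ord rmorphXn /= horner_mx_X.
set y := horner_mx X P; pose e a := horner_mx X (E a).
have Ee a G : a \in r -> ('X - a%:P) ^+ n.+1 %| G -> horner_mx X G *m e a = 0.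
  move=> ar HG; rewrite -[_ *m _]rmorphM; apply: zero => b; rewrite rs => br.
  have := HE a b br; case: eqVneq => [->|_] h; first by rewrite dvdp_mulr.
  by rewrite subr0 in h; rewrite dvdp_mull.
have eC a G : horner_mx X G *m e a = e a *m horner_mx X G.
  by rewrite -![_ *m _]rmorphM mulrC.
have sum1 : \sum_(a <- r) e a = 1%:M.
  apply/eqP; rewrite -subr_eq0 -rmorph_sum idmxE -(rmorph1 (horner_mx X)) -rmorphB.
  apply/eqP/zero => b; rewrite rs => br.
  have -> : \sum_(a <- r) E a - 1 = \sum_(a <- r) (E a - ((b == a)%:R)%:P).
    rewrite sumrB; congr (_ - _); rewrite (big_rem b) //= eqxx big_seq big1 ?addr0 //.
    move=> a; rewrite mem_rem_uniq // inE => /andP[ab _].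
    by rewrite eq_sym (negbTE ab).
  rewrite big_seq; elim/big_ind: _ => [|p q|a ar]; rewrite ?dvdp0 //.
    exact: dvdp_add.
  exact: HE.
have ye a : a \in r -> y *m e a = a^* *: e a.
  move=> ar; apply/eqP; rewrite -subr_eq0 -[_ *: _]mul_scalar_mx -mulmxBl.
  by rewrite -(horner_mx_C X) -rmorphB Ee // HP.
have adlin : linear (fun N : 'M[C]_n.+1 => X *m N - N *m X).
  move=> a u v; rewrite mulmxDr mulmxDl -scalemxAl -scalemxAr scalerBr.
  by rewrite opprD addrACA.
have ylin : linear (fun N : 'M[C]_n.+1 => y *m N - N *m y).
  move=> a u v; rewrite mulmxDr mulmxDl -scalemxAl -scalemxAr scalerBr.
  by rewrite opprD addrACA.
move=> M.
(* Each block e_a M e_b lies in the generalized eigenspace of ad X for a - b, where both sides are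
   the scalar (a - b)^*. *)
have -> : M = \sum_(a <- r) \sum_(b <- r) e a *m M *m e b.
  under eq_bigr do rewrite -mulmx_sumr sum1 mulmx1.
  by rewrite -mulmx_suml sum1 mul1mx.
rewrite (lin_map_sum _ _ _ ylin) (lin_map_sum _ _ _ (poly_act_lin adlin _)).
rewrite big_seq [in RHS]big_seq; apply: eq_bigr => a ar.
rewrite (lin_map_sum _ _ _ ylin) (lin_map_sum _ _ _ (poly_act_lin adlin _)).
rewrite big_seq [in RHS]big_seq; apply: eq_bigr => b br.
rewrite (@poly_act_scalar _ _ _ adlin Q (a - b) (a - b)^* (n.+1 + n.+1)).
- rewrite !mulmxA ye // -!mulmxA -eC ye // -!scalemxAr -scalemxAl -scalerBl.
  by rewrite rmorphB.
- by apply: HQ; rewrite mem_undup; apply: allpairs_f.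
have -> : (fun w => X *m w - w *m X - (a - b) *: w) =
   (fun w => (X - a%:M) *m w - w *m (X - b%:M)).
  apply/funext => w; rewrite mulmxBl mulmxBr mul_scalar_mx mul_mx_scalar scalerBl.
  by rewrite !opprB addrACA [RHS]addrACA; congr (_ + _); rewrite addrC.
have pw c : (X - c%:M) ^+ n.+1 = horner_mx X (('X - c%:P) ^+ n.+1).
  by rewrite rmorphXn rmorphB /= horner_mx_X horner_mx_C.
by apply: iter_ad_nilp; rewrite pw; rewrite ?mulmxA ?Ee ?mul0mx // -!mulmxA -eC Ee // !mulmx0.
Qed.

(** Real parts are taken entrywise in P(X) and in the coefficients of Q; this commutes with
    multiplication by the real matrix x. No information is lost in the trace, which is nonnegative
    and therefore real. *)
Lemma replica (R : rcfType) n (x : 'M[R]_n) :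
  exists (y : 'M[R]_n) (q : {poly R}),
    (forall M, y *m M - M *m y = poly_act (fun N => x *m N - N *m x) q M) /\
    (\tr (x *m y) = 0 -> exists k, x ^+ k = 0).
Proof.
case: n x => [|n] x.
  by exists 0, 0; split=> [M|_]; [|exists 0%N]; apply/matrixP => -[].
pose X : 'M[complex R]_n.+1 := map_mx (real_complex R) x.
have [P [Q [hM [tr_ge0 tr_eq0]]]] := replica_closed X.
pose re := @complex.Re R.
have reS I r (F : I -> complex R) : re (\sum_(i <- r) F i) = \sum_(i <- r) re (F i).
  by apply: (big_morph re) => // -[a b] [].
have reM a (w : complex R) : re (a%:C%C * w) = a * re w.
  by case: w => b c; rewrite /re /= mul0r subr0.
have reMr a (w : complex R) : re (w * a%:C%C) = re w * a.
  by rewrite mulrC reM mulrC.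
pose y := map_mx re (horner_mx X P).
have reXl (N : 'M[complex R]_n.+1) : map_mx re (X *m N) = x *m map_mx re N.
  apply/matrixP => i j; rewrite !mxE reS; apply: eq_bigr => k _.
  by rewrite !mxE reM.
have reXr (N : 'M[complex R]_n.+1) (M : 'M[R]_n.+1) :
    map_mx re (N *m map_mx (real_complex R) M) = map_mx re N *m M.
  apply/matrixP => i j; rewrite !mxE reS; apply: eq_bigr => k _.
  by rewrite !mxE reMr.
have reXl' (N : 'M[complex R]_n.+1) (M : 'M[R]_n.+1) :
    map_mx re (map_mx (real_complex R) M *m N) = M *m map_mx re N.
  apply/matrixP => i j; rewrite !mxE reS; apply: eq_bigr => k _.
  by rewrite !mxE reM.
have reB (N M : 'M[complex R]_n.+1) : map_mx re (N - M) = map_mx re N - map_mx re M.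
  by apply/matrixP => i j; rewrite !mxE; case: (N i j) (M i j) => a b [].
exists y, (\poly_(i < size Q) re Q`_i); split=> [M|tr0]; last first.
  exists n.+1; apply: (map_mx_inj (f := real_complex R)).
  rewrite raddf0 rmorphXn /=; apply: tr_eq0.
  have : re (\tr (X *m horner_mx X P)) = 0.
    rewrite -[RHS]tr0 /mxtrace reS; apply: eq_bigr => i _.
    by rewrite -[in RHS]reXl [RHS]mxE.
  move: tr_ge0; rewrite lecE; case: (\tr _) => a b /= /andP[/eqP -> _] h.
  by rewrite /re /= in h; rewrite h.
have := congr1 (map_mx re) (hM (map_mx (real_complex R) M)).
rewrite reB reXr reXl' -/y => ->.
rewrite (poly_actE _ _ (size_poly _ _)) /poly_act.
have -> : forall (s : nat) (F : 'I_s -> 'M[complex R]_n.+1),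
    map_mx re (\sum_i F i) = \sum_i map_mx re (F i).
  move=> s F; apply/matrixP => i j; rewrite mxE !summxE reS.
  by apply: eq_bigr => k _; rewrite mxE.
apply: eq_bigr => i _; rewrite coef_poly ltn_ord.
have -> : iter i (fun N => X *m N - N *m X) (map_mx (real_complex R) M) =
   map_mx (real_complex R) (iter i (fun N => x *m N - N *m x) M).
  elim: (i : nat) => [|k IH] //=.
  by rewrite IH [RHS]map_mxB !map_mxM.
by apply/matrixP => k l; rewrite !mxE reMr.
Qed.

End Replica.

(** * Engel's theorem *)

Section Engel.
Context {R : realType} {g : vectType R} {br : g -> g -> g}.
Hypothesis Hlie : is_lie_bracket br.

Let linl y : linear (br^~ y). Proof. exact: (lie_linearl Hlie). Qed.
Let linr x : linear (br x). Proof. exact: (lie_linearr Hlie). Qed.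

Lemma br0l y : br 0 y = 0. Proof. exact: (lin_map0 (linl y)). Qed.
Lemma br0r x : br x 0 = 0. Proof. exact: (lin_map0 (linr x)). Qed.

Lemma brDl x y z : br (x + y) z = br x z + br y z.
Proof. exact: (lin_mapD x y (linl z)). Qed.
Lemma brDr x y z : br x (y + z) = br x y + br x z.
Proof. exact: (lin_mapD y z (linr x)). Qed.
Lemma brZl a x y : br (a *: x) y = a *: br x y.
Proof. exact: (lin_mapZ a x (linl y)). Qed.
Lemma brZr a x y : br x (a *: y) = a *: br x y.
Proof. exact: (lin_mapZ a y (linr x)). Qed.

Lemma br_anti x y : br x y = - br y x.
Proof.
apply/eqP; rewrite -addr_eq0; have := lie_alt Hlie (x + y).
by rewrite brDl !brDr !(lie_alt Hlie) add0r addr0 => ->.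
Qed.

Lemma br_jacobi x y z : br x (br y z) = br (br x y) z + br y (br x z).
Proof.
have /eqP := lie_jacobi Hlie x y z.
rewrite -addrA addr_eq0 => /eqP ->; rewrite opprD addrC (br_anti z (br x y)) opprK.
by congr (_ + _); rewrite (br_anti z x) -[- br x z]scaleN1r brZr scaleN1r opprK.
Qed.

Lemma mem_lie_comm (U V : {vspace g}) u v :
  u \in U -> v \in V -> br u v \in lie_comm br U V.
Proof.
move=> uU vV; rewrite (coord_vbasis uU) (lin_map_sum _ _ _ (linl v)).
apply: memv_suml => i _; rewrite brZl memvZ // (coord_vbasis vV).
rewrite (lin_map_sum _ _ _ (linr _)).
apply: memv_suml => j _; rewrite brZr memvZ // memv_span //.
by apply: allpairs_f; rewrite mem_nth // size_tuple.
Qed.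

Lemma lie_comm_sub (U V W : {vspace g}) :
  (forall u v, u \in U -> v \in V -> br u v \in W) -> (lie_comm br U V <= W)%VS.
Proof.
move=> h; apply/span_subvP => _ /allpairsP [[u v] [/= hu hv ->]].
by apply: h; apply: vbasis_mem.
Qed.

Lemma exists_max_vspace (P : {vspace g} -> Prop) (U0 : {vspace g}) : P U0 ->
  exists2 U, P U & forall V, P V -> (\dim V <= \dim U)%N.
Proof.
move=> PU0; pose Q n := `[< exists2 U : {vspace g}, P U & \dim U = n >].
have exQ : exists n, Q n by exists (\dim U0); apply/asboolP; exists U0.
have ubQ n : Q n -> (n <= \dim {: g})%N.
  by move=> /asboolP [U _ <-]; exact/dimvS/subvf.
case: (ex_maxnP exQ ubQ) => n /asboolP[U PU <-] maxU; exists U => // V PV.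
by apply: maxU; apply/asboolP; exists V.
Qed.

Lemma dimv_add_line (U : {vspace g}) v : v \notin U -> (\dim U < \dim (U + <[v]>))%N.
Proof.
move=> vU; rewrite ltnNge; apply: contra vU => h.
have /eqP -> : (U == U + <[v]>)%VS by rewrite eqEdim addvSl.
by rewrite (subvP (addvSr _ _)) // memv_line.
Qed.

(** A subspace of maximal dimension inside [P] exhausts it, since otherwise a line could be added.
    Kernels, orthogonals and centres described by formulas become subspaces in this way. *)
Lemma vspace_of_pred (P : g -> Prop) :
  P 0 -> (forall a u v, P u -> P v -> P (a *: u + v)) ->
  exists U : {vspace g}, forall v, (v \in U) <-> P v.
Proof.
move=> P0 Plin.
have [|U PU maxU] := @exists_max_vspace (fun U => forall v, v \in U -> P v) 0%VS.
  by move=> v; rewrite memv0 => /eqP ->.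
exists U => v; split=> [|Pv]; first exact: PU.
apply: contrapT => /negP vU; have := dimv_add_line vU; rewrite ltnNge maxU //.
move=> _ /memv_addP[u uU [_ /vlineP[k ->] ->]]; rewrite addrC.
by apply: Plin => //; exact: PU.
Qed.

(* Working relatively to a submodule W avoids quotient modules. *)
Lemma engel_relative d (K V W : {vspace g}) :
  (\dim K <= d)%N -> (K <= V)%VS ->
  {in K &, forall x y, br x y \in K} ->
  {in K & V, forall x y, br x y \in V} ->
  {in K & W, forall x y, br x y \in W} ->
  (W <= V)%VS -> ~~ (V <= W)%VS ->
  {in K & V, forall x y, exists N, iter N (br x) y = 0} ->
  exists v, [/\ v \in V, v \notin W & {in K, forall x, br x v \in W}].
Proof.
elim: d K V W => [|d IH] K V W dK KV Kalg KVm KWm WV VW nil.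
  have /subvPn [v vV vW] := VW; exists v; split=> // x.
  move: dK; rewrite leqn0 dimv_eq0 => /eqP ->; rewrite memv0 => /eqP ->.
  by rewrite br0l mem0v.
have [K0|K0] := eqVneq K 0%VS.
  by apply: IH => //; rewrite K0 dimv0.
pose P (L : {vspace g}) :=
  [/\ (L <= K)%VS, {in L &, forall x y, br x y \in L} & ~~ (K <= L)%VS].
have [|L [LK Lalg KL] maxL] := @exists_max_vspace P 0%VS.
  split; rewrite ?sub0v ?subv0 // => x y; rewrite !memv0 => /eqP -> _.
  by rewrite br0l.
have dL : (\dim L <= d)%N.
  rewrite -ltnS; apply: leq_trans dK; rewrite ltnNge; apply: contra KL => h.
  by have /eqP -> : L == K by rewrite eqEdim LK.
have LsubK := subvP LK; have KsubV := subvP KV.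
(* L is a proper subalgebra of K of maximal dimension. The induction hypothesis for L acting on K
   modulo L yields an element outside L that normalizes L, and maximality then gives K = L + <x>. *)
have [x [xK xL Lx]] : exists v, [/\ v \in K, v \notin L & {in L, forall x, br x v \in L}].
  apply: IH => // [x y xL yK|x y xL yK].
    by apply: Kalg => //; exact: LsubK.
  by apply: nil; [exact: LsubK|exact: KsubV].
have KE : (K <= L + <[x]>)%VS.
  apply: contrapT => /negP KLx; have := dimv_add_line xL; rewrite ltnNge maxL //.
  split=> //; first by rewrite subv_add LK -memvE.
  move=> _ _ /memv_addP[u uL [_ /vlineP[a ->] ->]] /memv_addP[v vL [_ /vlineP[b ->] ->]].
  apply: (subvP (addvSl L <[x]>)).
  rewrite brDl !brDr !brZl !brZr (lie_alt Hlie) !scaler0 addr0 (br_anti x).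
  by rewrite !memvD ?memvZ ?memvN ?Lx ?Lalg.
have [v [vV vW Lv]] : exists v, [/\ v \in V, v \notin W & {in L, forall x, br x v \in W}].
  apply: IH => //; first exact: subv_trans KV.
  - by move=> ? ? /LsubK; exact: KVm.
  - by move=> ? ? /LsubK; exact: KWm.
  - by move=> ? ? /LsubK; exact: nil.
(* [Q] describes the vectors of V that L sends into W. It is stable under x because x normalizes L;
   the last iterate of v under x that lies outside W is then sent into W by L and by x. *)
pose Q y := [/\ y \in V & {in L, forall z, br z y \in W}].
have Qx y : Q y -> Q (br x y).
  move=> [yV Ly]; split; first exact: KVm.
  move=> z zL; rewrite br_jacobi memvD //; first by apply: Ly; exact: Lx.
  by apply: KWm => //; exact: Ly.
have Qi i : Q (iter i (br x) v) by elim: i => [|i IHi] //=; exact: Qx.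
have exN : exists N, iter N (br x) v \in W.
  by have [N HN] := nil x v xK vV; exists N; rewrite HN mem0v.
case: (ex_minnP exN) => -[|j] /= hj minj; first by rewrite hj in vW.
exists (iter j (br x) v); split.
- by have [] := Qi j.
- by apply/negP => /minj; rewrite ltnn.
move=> z /(subvP KE) /memv_addP[u uL [_ /vlineP[a ->] ->]].
by rewrite brDl brZl memvD ?memvZ //; have [_ ->] := Qi j.
Qed.

(** Let W be a maximal proper subspace of D stable under D. Engel's theorem for D modulo W gives v
    outside W with [D, v] in W, so D = W + <v> by maximality, and [D, D] lies in W, against
    perfectness. *)
Lemma engel_perfect (D : {vspace g}) :
  lie_comm br D D = D ->
  {in D &, forall x y, exists N, iter N (br x) y = 0} -> D = 0%VS.
Proof.
move=> DD nil.
have Dalg : {in D &, forall x y, br x y \in D}.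
  by move=> x y xD yD; rewrite -DD mem_lie_comm.
apply/eqP; rewrite -subv0; apply: contrapT => /negP D0.
pose P (W : {vspace g}) :=
  [/\ (W <= D)%VS, {in D & W, forall x y, br x y \in W} & ~~ (D <= W)%VS].
have [|W [WD DW nDW] maxW] := @exists_max_vspace P 0%VS.
  by split; rewrite ?sub0v // => x y _; rewrite memv0 => /eqP ->; rewrite br0r mem0v.
have [v [vD vW Dv]] := engel_relative (leqnn _) (subvv D) Dalg Dalg DW WD nDW nil.
have hbr x y : x \in D -> y \in (W + <[v]>)%VS -> br x y \in W.
  move=> xD /memv_addP[u uW [_ /vlineP[a ->] ->]].
  by rewrite brDr brZr memvD ?memvZ ?Dv ?DW.
have DE : (D <= W + <[v]>)%VS.
  apply: contrapT => /negP h; have := dimv_add_line vW; rewrite ltnNge maxW //.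
  split=> //; first by rewrite subv_add WD -memvE.
  by move=> x y xD yW; apply: (subvP (addvSl W <[v]>)); exact: hbr.
move/negP: nDW; apply; rewrite -{1}DD; apply: lie_comm_sub => x y xD /(subvP DE).
exact: hbr.
Qed.

End Engel.

(** * Cartan's criterion and Casimir operators *)

Section Cartan.
Context {R : realType} {g : vectType R} {br : g -> g -> g}.
Hypothesis Hlie : is_lie_bracket br.

(* Matrices act on row vectors from the right, which reverses products. *)
Definition is_rep m (rho : g -> 'M[R]_m) : Prop :=
  linear rho /\ forall x y, rho (br x y) = rho y *m rho x - rho x *m rho y.

Lemma trace_form_invariant m (rho : g -> 'M[R]_m) z x y : is_rep rho ->
  \tr (rho (br z x) *m rho y) = - \tr (rho x *m rho (br z y)).
Proof.
move=> [_ hom].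
have trB (M N : 'M[R]_m) : \tr (M - N) = \tr M - \tr N by exact: raddfB.
rewrite !hom mulmxBl mulmxBr !trB opprB -!mulmxA; congr (_ - _).
by rewrite mxtrace_mulC -!mulmxA.
Qed.

Lemma lie_ideal_comm (a : {vspace g}) : lie_ideal br a ->
  lie_ideal br (lie_comm br a a) /\ (lie_comm br a a <= a)%VS.
Proof.
move=> Ia; split; last by apply: lie_comm_sub => u v _; exact: Ia.
move=> x y.
have [W HW] : exists W : {vspace g}, forall v, (v \in W) <-> br x v \in lie_comm br a a.
  apply: vspace_of_pred; first by rewrite (br0r Hlie) mem0v.
  by move=> c u v hu hv; rewrite (brDr Hlie) (brZr Hlie) memvD ?memvZ.
move=> yaa; apply/HW; move: y yaa; apply/subvP.
apply: lie_comm_sub => u v ua va; apply/HW; rewrite (br_jacobi Hlie).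
by rewrite memvD ?mem_lie_comm // ?Ia // (br_anti Hlie) memvN Ia.
Qed.

(** Let y be the replica of rho z. Then tr(rho [u, v] y) = tr(rho u [y, rho v]), and [y, rho v], a
    polynomial in ad (rho z) applied to rho v, belongs to rho(a). The trace therefore vanishes on
    all brackets, hence tr(rho z y) = 0, which is the nilpotency test. *)
Lemma rep_comm_nilpotent m (rho : g -> 'M[R]_m) (a : {vspace g}) z :
  is_rep rho -> lie_ideal br a ->
  {in a &, forall x y, \tr (rho x *m rho y) = 0} ->
  z \in lie_comm br a a -> exists k, rho z ^+ k = 0.
Proof.
move=> [rlin hom] Ia tr0 zaa; have [y [q [hq]]] := replica (rho z); apply.
have za : z \in a by move: zaa; apply/subvP; have [] := lie_ideal_comm Ia.
have [W HW] : exists W : {vspace g}, forall w, (w \in W) <-> \tr (rho w *m y) = 0.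
  apply: vspace_of_pred; first by rewrite (lin_map0 rlin) mul0mx raddf0.
  move=> c u v hu hv; rewrite rlin mulmxDl -scalemxAl mxtraceD !mxtraceZ.
  by rewrite hu hv mulr0 addr0.
have iter_ad v i : v \in a -> exists2 w, w \in a &
    iter i (fun N => rho z *m N - N *m rho z) (rho v) = rho w.
  move=> va; elim: i => [|i [w wa IH]] /=; first by exists v.
  by exists (br w z); rewrite ?IH ?hom // (br_anti Hlie) memvN Ia.
apply/HW; move: zaa; apply/subvP/lie_comm_sub => u v ua va; apply/HW.
rewrite hom mulmxBl raddfB /= -mulmxA mxtrace_mulC -!mulmxA -raddfB /= -mulmxBr.
rewrite hq /poly_act mulmx_sumr raddf_sum /= big1 // => i _.
have [w wa ->] := iter_ad v i va.
by rewrite -scalemxAr mxtraceZ tr0 // mulr0.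
Qed.

(** Induction on dimension: if [a, a] is smaller than a, it is solvable. If a is perfect, every rho
    x is nilpotent, hence so is ad x on a by faithfulness, and Engel's theorem gives a = 0. *)
Lemma cartan_solvable m (rho : g -> 'M[R]_m) (a : {vspace g}) :
  is_rep rho -> lie_ideal br a ->
  {in a, forall x, rho x = 0 -> x = 0} ->
  {in a &, forall x y, \tr (rho x *m rho y) = 0} ->
  lie_solvable br a.
Proof.
move=> rrep; have [rlin hom] := rrep.
have [d] := ubnP (\dim a); elim: d a => // d IH a; rewrite ltnS => da Ia faith tr0.
have [Iaa aa_a] := lie_ideal_comm Ia; have sub := subvP aa_a.
have [aaE|aaN] := eqVneq (lie_comm br a a) a; last first.
  have [k hk] : lie_solvable br (lie_comm br a a).
    apply: IH => //.
  - apply: leq_trans da; rewrite ltnNge; apply: contra aaN => h.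
    by rewrite eqEdim aa_a.
  - by move=> x /sub; exact: faith.
  - by move=> x y /sub xa /sub; exact: tr0.
  by exists k.+1; rewrite /lie_derived iterSr.
exists 0%N; apply: (engel_perfect Hlie aaE) => x y xa ya.
have [k hk] : exists k, rho x ^+ k = 0.
  by apply: rep_comm_nilpotent tr0 _; rewrite ?aaE.
have iter_br i : iter i (br x) y \in a /\
    rho (iter i (br x) y) = iter i (fun N => - rho x *m N - N *m - rho x) (rho y).
  elim: i => [|i [h1 h2]] /=; first by [].
  by split; [exact: Ia|rewrite hom h2 mulNmx mulmxN opprK addrC].
exists (k + k)%N; have [h1 h2] := iter_br (k + k)%N; apply: faith => //.
by rewrite h2; apply: iter_ad_nilp; rewrite exprNn hk mulr0 ?mul0mx ?mulmx0.
Qed.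

Hypothesis ss : lie_semisimple br.

Lemma cartan_ideal m (rho : g -> 'M[R]_m) (a : {vspace g}) :
  is_rep rho -> lie_ideal br a ->
  {in a, forall x, rho x = 0 -> x = 0} ->
  {in a &, forall x y, \tr (rho x *m rho y) = 0} ->
  a = 0%VS.
Proof. by move=> *; apply: ss => //; exact: (@cartan_solvable m rho). Qed.

Definition coord_row (v : g) : 'rV[R]_(\dim {: g}) :=
  \row_j coord (vbasis {: g}) j v.

Definition ad_mx (x : g) : 'M[R]_(\dim {: g}) :=
  \matrix_i coord_row (br x (vbasis {: g})`_i).

Lemma coord_row_lin : linear coord_row.
Proof. by move=> c u v; apply/rowP => j; rewrite !mxE linearP. Qed.

Lemma coord_row_inj : injective coord_row.
Proof.
move=> u v /rowP h; rewrite (coord_vbasis (memvf u)) (coord_vbasis (memvf v)).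
by apply: eq_bigr => i _; have := h i; rewrite !mxE => ->.
Qed.

Lemma coord_row_ad x v : coord_row v *m ad_mx x = coord_row (br x v).
Proof.
rewrite [in RHS](coord_vbasis (memvf v)) (lin_map_sum _ _ _ (lie_linearr Hlie x)).
rewrite (lin_map_sum _ _ _ coord_row_lin) mulmx_sum_row; apply: eq_bigr => i _.
by rewrite mxE rowK (brZr Hlie) (lin_mapZ _ _ coord_row_lin).
Qed.

Lemma ad_mx_rep : is_rep ad_mx.
Proof.
have rowad x i : row i (ad_mx x) = coord_row (br x (vbasis {: g})`_i) by rewrite rowK.
split=> [c x y|x y]; apply/row_matrixP => i.
  rewrite linearP /= !rowad (brDl Hlie) (brZl Hlie) coord_row_lin.
  by [].
rewrite linearB /= !row_mul !rowad !coord_row_ad (br_jacobi Hlie x).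
by rewrite (lin_mapD _ _ coord_row_lin) addrK.
Qed.

(** The kernel of ad is the centre, an abelian ideal, hence zero by semisimplicity. *)
Lemma ad_mx_faithful x : ad_mx x = 0 -> x = 0.
Proof.
have [Z HZ] : exists Z : {vspace g}, forall x, (x \in Z) <-> forall v, br x v = 0.
  apply: vspace_of_pred => [v|c u w hu hw v]; first exact: (br0l Hlie).
  by rewrite (brDl Hlie) (brZl Hlie) hu hw scaler0 addr0.
have Z0 : Z = 0%VS.
  apply: ss => [u v /HZ hv|].
    by rewrite (br_anti Hlie) hv oppr0 mem0v.
  exists 1%N; apply/eqP; rewrite -subv0; apply: lie_comm_sub => u v /HZ -> _.
  exact: mem0v.
move=> h; have : x \in Z.
  apply/HZ => v; apply: coord_row_inj.
  by rewrite -coord_row_ad h mulmx0 (lin_map0 coord_row_lin).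
by rewrite Z0 memv0 => /eqP.
Qed.

(* C is the Casimir operator of the trace form of rho on the Killing orthogonal
   of ker rho, an ideal on which rho is faithful. *)
Lemma casimir m (rho : g -> 'M[R]_m) : is_rep rho -> (exists x, rho x <> 0) ->
  exists d (e : 'I_d -> g) (b : 'M[R]_d),
    let C := \sum_i \sum_j b i j *: (rho (e i) *m rho (e j)) in
    (forall x, C *m rho x = rho x *m C) /\ \tr C != 0.
Proof.
move=> rrep [x0 rx0]; have [rlin hom] := rrep; have [adlin adhom] := ad_mx_rep.
have [K HK] : exists K : {vspace g}, forall x, (x \in K) <-> rho x = 0.
  apply: vspace_of_pred => [|c u v hu hv]; first exact: lin_map0.
  by rewrite rlin hu hv scaler0 addr0.
have IK : lie_ideal br K.
  by move=> x y /HK hy; apply/HK; rewrite hom hy mul0mx mulmx0 subr0.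
have [S HS] : exists S : {vspace g}, forall x, (x \in S) <->
    forall y, y \in K -> \tr (ad_mx x *m ad_mx y) = 0.
  apply: vspace_of_pred => [y _|c u v hu hv y yK].
    by rewrite (lin_map0 adlin) mul0mx raddf0.
  rewrite adlin mulmxDl -scalemxAl mxtraceD !mxtraceZ hu // hv //.
  by rewrite mulr0 addr0.
have IS : lie_ideal br S.
  move=> x y /HS hy; apply/HS => z zK; rewrite (trace_form_invariant _ _ _ ad_mx_rep).
  by rewrite hy ?oppr0 // IK.
(* The Killing form vanishes on the ideal K :&: S, so Cartan's criterion applies to it in the
   adjoint representation. *)
have KS0 : (K :&: S)%VS = 0%VS.
  apply: (cartan_ideal ad_mx_rep).
  - by move=> x y; rewrite !memv_cap => /andP[h1 h2]; rewrite IK ?IS.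
  - by move=> x _; exact: ad_mx_faithful.
  - by move=> x y; rewrite !memv_cap => /andP[_ /HS h] /andP[/h].
have Sfaith : {in S, forall x, rho x = 0 -> x = 0}.
  by move=> x xS /HK xK; apply/eqP; rewrite -memv0 -KS0 memv_cap xK.
have [r Hr] : exists r : {vspace g}, forall x, (x \in r) <->
    x \in S /\ forall y, y \in S -> \tr (rho x *m rho y) = 0.
  apply: vspace_of_pred => [|c u v [uS hu] [vS hv]]; split.
  - exact: mem0v.
  - by move=> y _; rewrite (lin_map0 rlin) mul0mx raddf0.
  - by rewrite memvD ?memvZ.
  move=> y yS; rewrite rlin mulmxDl -scalemxAl mxtraceD !mxtraceZ hu // hv //.
  by rewrite mulr0 addr0.
have r0 : r = 0%VS.
  apply: (cartan_ideal rrep).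
  - move=> x y /Hr[yS hy]; apply/Hr; split; first exact: IS.
    move=> z zS; rewrite (trace_form_invariant _ _ _ rrep).
    by rewrite hy ?oppr0 // IS.
  - by move=> x /Hr[xS _]; exact: Sfaith.
  - by move=> x y /Hr[_ hx] /Hr[yS _]; exact: hx.
(* If S were zero, the Killing form would embed g into the dual of K; then K = g by dimension, and
   rho would vanish. *)
have S_neq0 : (0 < \dim S)%N.
  rewrite lt0n dimv_eq0; apply/negP => /eqP S0; apply: rx0; apply/HK.
  pose M : 'M[R]_(\dim {: g}, \dim K) := \matrix_(i, j)
    \tr (ad_mx (vbasis {: g})`_i *m ad_mx (vbasis K)`_j).
  have Mfree : row_free M.
    apply/inj_row_free => u uM.
    suff s0 : \sum_i u 0 i *: (vbasis {: g})`_i = 0.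
      apply/rowP => i; rewrite mxE.
      by have /freeP := basis_free (vbasisP {: g}); apply.
    apply/eqP; rewrite -memv0 -S0; apply/HS => y yK.
    rewrite (coord_vbasis yK) !(lin_map_sum _ _ _ adlin) mulmx_sumr raddf_sum /=.
    apply: big1 => j _; rewrite (lin_mapZ _ _ adlin) -scalemxAr mxtraceZ.
    rewrite mulmx_suml raddf_sum /=.
    move/rowP/(_ j): uM; rewrite !mxE => uM.
    rewrite [X in _ * X](_ : _ = 0) ?mulr0 // -[RHS]uM.
    by apply: eq_bigr => k _; rewrite (lin_mapZ _ _ adlin) -scalemxAl mxtraceZ mxE.
  have : (\dim {: g} <= \dim K)%N by move: Mfree => /eqP <-; exact: rank_leq_col.
  move=> h; have /eqP -> : K == fullv by rewrite eqEdim subvf.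
  exact: memvf.
pose e := fun i : 'I_(\dim S) => (vbasis S)`_i.
have eS i : e i \in S by rewrite vbasis_mem // mem_nth // size_tuple.
pose B : 'M[R]_(\dim S) := \matrix_(i, j) \tr (rho (e i) *m rho (e j)).
have Bunit : B \in unitmx.
  rewrite -row_free_unit; apply/inj_row_free => u uB.
  suff s0 : \sum_i u 0 i *: e i = 0.
    apply/rowP => i; rewrite mxE.
    by have /freeP := basis_free (vbasisP S); apply.
  apply/eqP; rewrite -memv0 -r0; apply/Hr; split.
    by apply: memv_suml => i _; rewrite memvZ.
  move=> y yS; rewrite (coord_vbasis yS) !(lin_map_sum _ _ _ rlin) mulmx_sumr raddf_sum /=.
  apply: big1 => j _; rewrite (lin_mapZ _ _ rlin) -scalemxAr mxtraceZ.
  rewrite mulmx_suml raddf_sum /=.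
  move/rowP/(_ j): uB; rewrite !mxE => uB.
  rewrite [X in _ * X](_ : _ = 0) ?mulr0 // -[RHS]uB.
  by apply: eq_bigr => k _; rewrite (lin_mapZ _ _ rlin) -scalemxAl mxtraceZ mxE.
exists (\dim S), e, (invmx B); move=> C; split; last first.
  (* With B the Gram matrix of the trace form, tr C = tr(B^-1 B), which is nonzero in characteristic
     0. *)
  suff -> : \tr C = (\dim S)%:R by rewrite pnatr_eq0 -lt0n.
  rewrite -(mxtrace1 R (\dim S)) -(mulVmx Bunit) /C raddf_sum /=; apply: eq_bigr => i _.
  rewrite raddf_sum /= mxE; apply: eq_bigr => j _ /=.
  by rewrite mxtraceZ mxE mxtrace_mulC.
move=> z.
pose a : 'M[R]_(\dim S) := \matrix_(i, j) coord (vbasis S) j (br z (e i)).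
have brE i : br z (e i) = \sum_j a i j *: e j.
  have h : br z (e i) \in S by exact: IS.
  by rewrite [LHS](coord_vbasis h); apply: eq_bigr => j _; rewrite mxE.
(* Invariance of the trace form, with a the matrix of ad z on S. Multiplying by B^-1 on both sides
   makes it the invariance of the tensor B^-1, whose failure is what [C, rho z] measures below. *)
have aB : a *m B + B *m a^T = 0.
  apply/matrixP => i j; rewrite !mxE.
  have inv0 : \tr (rho (br z (e i)) *m rho (e j)) + \tr (rho (e i) *m rho (br z (e j))) = 0.
    by rewrite (trace_form_invariant _ _ _ rrep) addNr.
  rewrite -[RHS]inv0 !brE !(lin_map_sum _ _ _ rlin) mulmx_suml mulmx_sumr !raddf_sum /=.
  congr (_ + _); apply: eq_bigr => k _; rewrite (lin_mapZ _ _ rlin) !mxE.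
    by rewrite -scalemxAl mxtraceZ.
  by rewrite -scalemxAr mxtraceZ mulrC.
have aBV : invmx B *m a + a^T *m invmx B = 0.
  have := congr1 (fun M => invmx B *m M *m invmx B) aB.
  rewrite mulmxDr mulmxDl !mulmxA mulVmx // mul1mx mulmxK //.
  by rewrite mulmx0 mul0mx.
apply/eqP; rewrite -subr_eq0; apply/eqP.
have comm1 x : rho x *m rho z = rho z *m rho x + rho (br z x).
  by rewrite hom addrC subrK.
have -> : C *m rho z - rho z *m C =
  \sum_i \sum_j invmx B i j *: (rho (br z (e i)) *m rho (e j) + rho (e i) *m rho (br z (e j))).
  rewrite /C mulmx_suml mulmx_sumr -sumrB; apply: eq_bigr => i _.
  rewrite mulmx_suml mulmx_sumr -sumrB; apply: eq_bigr => j _.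
  rewrite -scalemxAl -scalemxAr -scalerBr; congr (_ *: _).
  rewrite -mulmxA comm1 mulmxDr !mulmxA comm1 mulmxDl addrAC [X in X + _]addrAC.
  by rewrite subrr add0r.
transitivity (\sum_k \sum_l
  (invmx B *m a + a^T *m invmx B) k l *: (rho (e k) *m rho (e l))); last first.
  by rewrite aBV big1 // => k _; rewrite big1 // => l _; rewrite mxE scale0r.
transitivity (\sum_i \sum_j \sum_k
  ((invmx B i j * a i k) *: (rho (e k) *m rho (e j)) +
   (invmx B i j * a j k) *: (rho (e i) *m rho (e k)))).
  apply: eq_bigr => i _; apply: eq_bigr => j _.
  rewrite !brE !(lin_map_sum _ _ _ rlin) mulmx_suml mulmx_sumr -big_split scaler_sumr.
  apply: eq_bigr => k _ /=; rewrite !(lin_mapZ _ _ rlin) -scalemxAl -scalemxAr.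
  by rewrite scalerDr !scalerA.
transitivity (\sum_k \sum_l (\sum_j
  ((invmx B k j * a j l) *: (rho (e k) *m rho (e l)) +
   (a j k * invmx B j l) *: (rho (e k) *m rho (e l))))); last first.
  apply: eq_bigr => k _; apply: eq_bigr => l _; rewrite big_split /= -!scaler_suml -scalerDl.
  rewrite [in RHS]mxE; congr ((_ + _) *: _); rewrite [RHS]mxE.
    by [].
  by apply: eq_bigr => j _; rewrite [a^T _ _]mxE.
under eq_bigr do under eq_bigr do rewrite big_split.
under [RHS]eq_bigr do under eq_bigr do rewrite big_split.
under eq_bigr do rewrite big_split.
under [RHS]eq_bigr do rewrite big_split.
rewrite !big_split /= addrC; congr (_ + _).
  by apply: eq_bigr => k _; rewrite exchange_big.
rewrite exchange_big /= [RHS]exchange_big /=; apply: eq_bigr => l _.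
rewrite exchange_big /=; apply: eq_bigr => k _; apply: eq_bigr => j _.
by rewrite mulrC.
Qed.

End Cartan.

(** * Invariants and image of a representation *)

Lemma mxtrace_nilpotent_closed (C : numClosedFieldType) n (X : 'M[C]_n.+1) k :
  X ^+ k = 0 -> \tr X = 0.
Proof.
move=> Xk.
have [U Uu tT] := Schur X (ltn0Sn n).
have Uunit : U \in unitmx by rewrite unitarymx_unit.
have [T trT XT] : exists2 T, is_trig_mx T & X = invmx U *m T *m U.
  exists (conjmx U X); first exact: tT.
  by rewrite conjumx // !mulmxA mulVmx // mul1mx mulmxKV.
rewrite XT -mulmxA mxtrace_mulC -mulmxA mulmxV // mulmx1 /mxtrace.
apply: big1 => i _; apply/eqP.
have : horner_mx X 'X^k = 0 by rewrite rmorphXn /= horner_mx_X.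
rewrite XT horner_mx_uconjC // => /(congr1 (fun M => U *m M *m invmx U)).
rewrite !mulmxA mulmxV // mul1mx mulmxK // mulmx0 mul0mx => Tk.
have [_ /(_ i)] := mxtrace_horner_trig 'X^k trT.
by rewrite Tk mxE hornerXn => /esym/eqP; rewrite expf_eq0 => /andP[].
Qed.

Lemma mxtrace_nilpotent (R : rcfType) n (x : 'M[R]_n) k : x ^+ k = 0 -> \tr x = 0.
Proof.
case: n x => [|n] x xk; first by rewrite /mxtrace big_ord0.
apply: (fmorph_inj (real_complex R)); rewrite rmorph0 -trace_map_mx.
apply: (@mxtrace_nilpotent_closed _ _ _ k).
by rewrite -rmorphXn /= xk map_mx0.
Qed.

Section Decomposition.
Context {R : realType} {g : vectType R} {br : g -> g -> g}.
Hypothesis Hlie : is_lie_bracket br.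
Hypothesis ss : lie_semisimple br.

(** A predicate rather than a subspace: it will be the pullback of a set of polynomials such as
    I(O), and its restriction to ker Z in the induction is a mere substitution. *)
Definition subrep m (rho : g -> 'M[R]_m) (I : 'rV[R]_m -> Prop) : Prop :=
  [/\ I 0, forall a u v, I u -> I v -> I (a *: u + v) &
      forall v x, I v -> I (v *m rho x)].

Definition invariant m (rho : g -> 'M[R]_m) (v : 'rV[R]_m) : Prop :=
  forall x, v *m rho x = 0.

Definition action_image m (rho : g -> 'M[R]_m) (I : 'rV[R]_m -> Prop)
    (v : 'rV[R]_m) : Prop :=
  exists2 w : 'I_(\dim {: g}) -> 'rV[R]_m, forall i, I (w i) &
    v = \sum_i w i *m rho (vbasis {: g})`_i.

Section Basics.
Variables (m : nat) (rho : g -> 'M[R]_m) (I : 'rV[R]_m -> Prop).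
Hypothesis (rrep : is_rep (br := br) rho) (Isub : subrep rho I).

Lemma subrepD u v : I u -> I v -> I (u + v).
Proof. by move=> Iu Iv; rewrite -[u]scale1r; case: Isub => _ h _; exact: h. Qed.

Lemma subrepZ a u : I u -> I (a *: u).
Proof. by move=> Iu; rewrite -[_ *: _]addr0; case: Isub => h0 h _; exact: h. Qed.

Lemma subrep_sum J (r : seq J) (F : J -> 'rV[R]_m) :
  (forall j, I (F j)) -> I (\sum_(j <- r) F j).
Proof.
by move=> h; apply: big_ind => //; [case: Isub|exact: subrepD].
Qed.

Lemma action_imageD u v :
  action_image rho I u -> action_image rho I v -> action_image rho I (u + v).
Proof.
move=> [w Iw ->] [w' Iw' ->]; exists (fun i => w i + w' i) => [i|].
  exact: subrepD.
by rewrite -big_split; apply: eq_bigr => i _; rewrite mulmxDl.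
Qed.

Lemma action_image0 : action_image rho I 0.
Proof.
exists (fun=> 0) => [i|]; first by case: Isub.
by rewrite big1 // => i _; rewrite mul0mx.
Qed.

Lemma action_image_act u x : I u -> action_image rho I (u *m rho x).
Proof.
move=> Iu; exists (fun i => coord (vbasis {: g}) i x *: u) => [i|].
  exact: subrepZ.
rewrite [in LHS](coord_vbasis (memvf x)) (lin_map_sum _ _ _ (proj1 rrep)).
rewrite mulmx_sumr; apply: eq_bigr => i _.
by rewrite (lin_mapZ _ _ (proj1 rrep)) -scalemxAr -scalemxAl.
Qed.

Lemma action_image_sum J (r : seq J) (F : J -> 'rV[R]_m) :
  (forall j, action_image rho I (F j)) -> action_image rho I (\sum_(j <- r) F j).
Proof.
by move=> h; apply: big_ind => //; [exact: action_image0|exact: action_imageD].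
Qed.

End Basics.

Lemma subrep_horner m (rho : g -> 'M[R]_m.+1) (I : 'rV[R]_m.+1 -> Prop) X p v :
  subrep rho I -> (forall u, I u -> I (u *m X)) -> I v -> I (v *m horner_mx X p).
Proof.
move=> Isub IX Iv; elim/poly_ind: p => [|p c IH].
  by rewrite rmorph0 mulmx0; case: Isub.
rewrite rmorphD rmorphM /= horner_mx_X horner_mx_C mulmxDr mulmxA mul_mx_scalar.
by apply: (subrepD Isub); [exact: IX|exact: (subrepZ Isub)].
Qed.

(** The predicate [I] is carried through the induction: polynomials in the Casimir operator preserve
    it, and on ker Z it becomes t |-> I (t U). *)
Lemma rep_decomposition m (rho : g -> 'M[R]_m) : is_rep (br := br) rho ->
  (forall I v, subrep rho I -> I v ->
     exists v0 w, [/\ I v0, invariant rho v0, action_image rho I w & v = v0 + w]) /\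
  (forall v, invariant rho v -> action_image rho (fun=> True) v -> v = 0).
Proof.
have [d] := ubnP m; elim: d m rho => // d IH m rho; rewrite ltnS => md rrep.
have [[x rx]|rho0] := pselect (exists x, rho x <> 0); last first.
  have {}rho0 x : rho x = 0 by apply: contrapT => h; apply: rho0; exists x.
  split=> [I v Isub Iv|v _ [w _ ->]].
    exists v, 0; split=> //; [by move=> x; rewrite rho0 mulmx0| |by rewrite addr0].
    exact: action_image0.
  by rewrite big1 // => i _; rewrite rho0 mulmx0.
case: m => [|m] in rho rrep x rx md *; first by case: rx; apply/matrixP => -[].
have [n [e [b /= [Ccomm Ctr]]]] := casimir Hlie ss rrep (ex_intro _ x rx).
set C := \sum_i _ in Ccomm Ctr.
have CE v : v *m C = \sum_j (\sum_i b i j *: (v *m rho (e i))) *m rho (e j).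
  rewrite /C exchange_big mulmx_sumr; apply: eq_bigr => j _.
  rewrite mulmx_sumr mulmx_suml; apply: eq_bigr => i _.
  by rewrite -scalemxAr -scalemxAl mulmxA.
have Cimage I v : subrep rho I -> I v -> action_image rho I (v *m C).
  move=> Isub Iv; rewrite CE; apply: (action_image_sum Isub) => j.
  apply: (action_image_act rrep Isub); apply: (subrep_sum Isub) => i.
  by apply: (subrepZ Isub); case: Isub => _ _; exact.
have CI I v : subrep rho I -> I v -> I (v *m C).
  move=> Isub Iv; rewrite CE; apply: (subrep_sum Isub) => j.
  have [_ _ h] := Isub; apply: (h); apply: (subrep_sum Isub) => i.
  by apply: (subrepZ Isub); exact: h.
have [k [h h0 chE]] := multiplicity_XsubC (char_poly C) 0.
have ch0 : char_poly C != 0 by rewrite monic_neq0 // char_poly_monic.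
rewrite ch0 /= in h0; rewrite subr0 in chE.
(* Here char C = h X^k with h(0) nonzero. Bezout makes P = pi(C) the Fitting projection onto ker Z.
   The exponent k + 1 leaves a factor C in Z even if k = 0, and this factor puts v - v P into
   g.V. *)
have : coprimep h 'X^(k.+1) by rewrite coprimep_expr // coprimepX.
case/Bezout_eq1_coprimepP => u; set pi := u.1 * h => Hu.
pose P := horner_mx C pi; pose Z := C ^+ k.+1.
have ZE : Z = horner_mx C 'X^(k.+1) by rewrite rmorphXn /= horner_mx_X.
have PZ1 : P + horner_mx C u.2 *m Z = 1%:M.
  by rewrite ZE -[_ *m _]rmorphM -rmorphD Hu rmorph1.
have PZ0 : P *m Z = 0.
  rewrite ZE -[_ *m _]rmorphM /pi exprSr mulrA -[u.1 * h * _]mulrA -chE.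
  by rewrite !rmorphM /= Cayley_Hamilton mulr0 mul0r.
pose U := row_base (kermx Z).
have Ufree : row_free U := row_base_free _.
have PU v : (v *m P <= U)%MS.
  by rewrite eq_row_base; apply/sub_kermxP; rewrite -mulmxA PZ0 mulmx0.
have Zcomm y : Z *m rho y = rho y *m Z.
  rewrite /Z; elim: k.+1 => [|i IHi]; first by rewrite expr0 mulmx1 mul1mx.
  by rewrite exprS -mulmxA [_ *m rho y]IHi !mulmxA Ccomm.
have Ustable y : stablemx U (rho y).
  rewrite stablemx_row_base; apply/sub_kermxP.
  by rewrite -mulmxA -Zcomm mulmxA mulmx_ker mul0mx.
pose rhoU y := conjmx U (rho y).
have rhoUK t y : t *m rhoU y *m U = t *m U *m rho y.
  by rewrite -mulmxA /rhoU /conjmx mulmxKpV ?mulmxA.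
have rhoUrep : is_rep (br := br) rhoU.
  have [rlin hom] := rrep; split=> [a y z|y z].
    by rewrite /rhoU /conjmx rlin mulmxDr mulmxDl -scalemxAr -scalemxAl.
  rewrite /rhoU hom /conjmx mulmxBr mulmxBl -![_ *m pinvmx U]/(conjmx U _).
  by rewrite !conjmxM // inE.
(* C has nonzero trace, so it is not nilpotent; Z is nonzero and its kernel is proper. *)
have rkU : (\rank (kermx Z) < d)%N.
  apply: leq_trans md; rewrite ltnS mxrank_ker; rewrite leq_subLR.
  rewrite -[X in (X <= _)%N]add1n leq_add2r lt0n mxrank_eq0.
  by apply: contra Ctr => /eqP /mxtrace_nilpotent ->.
have [IHa IHb] := IH _ rhoU rkU rhoUrep.
have PUK v : v *m P *m pinvmx U *m U = v *m P by rewrite mulmxKpV.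
have split1 v : v = v *m P + v *m horner_mx C u.2 *m C ^+ k *m C.
  rewrite -[_ *m C ^+ k *m C]mulmxA -[C ^+ k *m C]exprSr -/Z -mulmxA -mulmxDr PZ1.
  by rewrite mulmx1.
split=> [I v Isub Iv|v vinv [w _ vE]].
  have IsubU : subrep rhoU (fun t => I (t *m U)).
    have [I0 Il Ia] := Isub; split=> [|a s t hs ht|t y It].
    - by rewrite mul0mx.
    - by rewrite mulmxDl -scalemxAl; exact: Il.
    - by rewrite rhoUK; exact: Ia.
  have Ih p y : I y -> I (y *m horner_mx C p).
    exact: (@subrep_horner _ rho I C p y Isub (fun z => CI I z Isub)).
  have IC i y : I y -> I (y *m C ^+ i).
    by move=> Iy; rewrite -[C](horner_mx_X C) -rmorphXn; exact: Ih.
  have [|t0 [t1 [It0 t0inv [w Iw t1E] tE]]] := IHa _ (v *m P *m pinvmx U) IsubU.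
    by rewrite PUK; exact: Ih.
  exists (t0 *m U), (t1 *m U + v *m horner_mx C u.2 *m C ^+ k *m C); split=> //.
  - by move=> y; rewrite -rhoUK t0inv mul0mx.
  - apply: (action_imageD Isub); last by apply: Cimage => //; apply: IC; exact: Ih.
    exists (fun i => w i *m U) => //.
    by rewrite t1E mulmx_suml; apply: eq_bigr => i _; rewrite rhoUK.
  by rewrite addrA -mulmxDl -tE PUK -split1.
(* An invariant vector is killed by C, hence fixed by P. Since P commutes with g, it moves the
   expression of v as an element of g.V into ker Z, where the induction hypothesis applies. *)
have vC : v *m C = 0.
  by rewrite CE big1 // => j _; rewrite big1 ?mul0mx // => i _; rewrite vinv scaler0.
have Pcomm y : P *m rho y = rho y *m P.
  rewrite /P; elim/poly_ind: pi {Hu P PZ1 PZ0 PU PUK split1} => [|p c IHp].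
    by rewrite rmorph0 mul0mx mulmx0.
  rewrite rmorphD rmorphM /= horner_mx_X horner_mx_C mulmxDl mulmxDr -mulmxA Ccomm.
  by rewrite mulmxA IHp -mulmxA scalar_mxC.
have vP : v *m P = v.
  have PC : horner_mx C u.2 *m Z = Z *m horner_mx C u.2.
    by rewrite ZE -![_ *m _]rmorphM mulrC.
  by rewrite -[RHS]mulmx1 -PZ1 mulmxDr PC /Z exprS !mulmxA vC !mul0mx addr0.
pose t := v *m P *m pinvmx U.
have tU : t *m U = v by rewrite PUK.
suff t0 : t = 0 by rewrite -tU t0 mul0mx.
apply: IHb => [y|].
  by apply: (row_free_inj Ufree); rewrite rhoUK tU vinv mul0mx.
exists (fun i => w i *m P *m pinvmx U) => //.
apply: (row_free_inj Ufree); rewrite tU -vP {1}vE !mulmx_suml; apply: eq_bigr => i _.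
by rewrite rhoUK PUK -!mulmxA Pcomm.
Qed.

End Decomposition.

(** * The adjoint action on the symmetric algebra *)

Section PoissonAlgebra.
Context {R : realType} {g : vectType R} {br : g -> g -> g}.
Hypothesis Hlie : is_lie_bracket br.
Local Notation n0 := (\dim {: g}).
Local Notation S := (sym_alg (g := g)).
Local Notation E i := (vbasis {: g})`_i.
Local Notation msz := (mmeasure (@mdeg n0)).

Definition ham (x : g) (p : S) : S := lie_poisson br (sym_inj x) p.

Lemma lie_poisson_lin p : linear (lie_poisson br p).
Proof.
move=> a u v; rewrite /lie_poisson scaler_sumr -big_split; apply: eq_bigr => i _ /=.
rewrite scaler_sumr -big_split; apply: eq_bigr => j _ /=.
by rewrite mderivD mderivZ mulrDr mulrDl -scalerAr -scalerAl.
Qed.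

Lemma hamE x p : ham x p = \sum_j mderiv j p * sym_inj (br x (E j)).
Proof.
rewrite /ham /lie_poisson exchange_big; apply: eq_bigr => j _ /=.
rewrite [x in RHS](coord_vbasis (memvf x)).
rewrite (lin_map_sum _ _ _ (lie_linearl Hlie (E j))).
rewrite (lin_map_sum _ _ _ (@sym_inj_linear _ g)) mulr_sumr; apply: eq_bigr => i _.
rewrite mderiv_sym_inj (brZl Hlie) (lin_mapZ _ _ (@sym_inj_linear _ g)).
by rewrite mul_mpolyC -!scalerAl -scalerAr.
Qed.

Lemma ham_lin x : linear (ham x).
Proof. exact: lie_poisson_lin. Qed.

Lemma hamDl a x y p : ham (a *: x + y) p = a *: ham x p + ham y p.
Proof.
rewrite !hamE scaler_sumr -big_split; apply: eq_bigr => j _ /=.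
by rewrite (brDl Hlie) (brZl Hlie) sym_inj_linear mulrDr -scalerAr.
Qed.

Lemma hamM x p q : ham x (p * q) = p * ham x q + ham x p * q.
Proof. exact: lie_poissonMr. Qed.

Lemma ham_inj x y : ham x (sym_inj y) = sym_inj (br x y).
Proof. exact: lie_poisson_inj. Qed.

(** In the commutator the second-order terms cancel by symmetry of second derivatives; the
    first-order terms are the Jacobi identity. *)
Lemma ham_br x y p : ham (br x y) p = ham x (ham y p) - ham y (ham x p).
Proof.
have comp u v : ham u (ham v p) =
    \sum_j \sum_k mderiv k (mderiv j p) * (sym_inj (br v (E j)) * sym_inj (br u (E k))) +
    \sum_j mderiv j p * sym_inj (br u (br v (E j))).
  rewrite [ham v p]hamE (lin_map_sum _ _ _ (ham_lin u)) -big_split.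
  apply: eq_bigr => j _ /=; rewrite hamM ham_inj addrC; congr (_ + _).
  rewrite hamE mulr_suml; apply: eq_bigr => k _.
  by rewrite -!mulrA; congr (_ * _); rewrite mulrC.
rewrite !comp hamE opprD addrACA exchange_big /= -sumrB -sumrB [X in _ = X + _]big1.
  rewrite add0r; apply: eq_bigr => j _; rewrite -mulrBr; congr (_ * _).
  rewrite -(lin_mapB _ _ (@sym_inj_linear _ g)); congr sym_inj.
  by rewrite [br x (br y _)](br_jacobi Hlie) addrK.
move=> j _; rewrite -sumrB big1 // => k _; rewrite mderiv_comm.
by rewrite [sym_inj (br y _) * _]mulrC subrr.
Qed.

(** By the Leibniz rule the two sides differ by q times sum_i {e_i, d_i p}, which contracts the
    symmetric second derivatives of p with the antisymmetric bracket and so vanishes. *)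
Lemma lie_poisson_ham p q : lie_poisson br p q = \sum_(i < n0) ham (E i) (mderiv i p * q).
Proof.
have symm (i j : 'I_n0) : mderiv j (mderiv i p) * sym_inj (br (E i) (E j)) =
  - (mderiv i (mderiv j p) * sym_inj (br (E j) (E i))).
  rewrite mderiv_comm (br_anti Hlie) -scaleN1r (lin_mapZ _ _ (@sym_inj_linear _ g)).
  by rewrite scaleN1r mulrN.
have sum0 : \sum_(i < n0) ham (E i) (mderiv i p) = 0.
  under eq_bigr do rewrite hamE.
  set s := LHS; have : s = - s.
    rewrite {1}/s exchange_big -sumrN; apply: eq_bigr => i _ /=.
    by rewrite -sumrN; apply: eq_bigr => j _; exact: symm.
  move=> /eqP; rewrite -addr_eq0 -mulr2n -scaler_nat scaler_eq0 pnatr_eq0 /=.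
  by move=> /eqP.
under eq_bigr do rewrite hamM addrC.
rewrite big_split /= -mulr_suml sum0 mul0r add0r; apply: eq_bigr => i _.
by rewrite hamE mulr_sumr; apply: eq_bigr => j _; rewrite mulrA.
Qed.

Lemma ham_const x c : ham x (mpolyC _ c) = 0.
Proof. by rewrite hamE big1 // => j _; rewrite mderivC mul0r. Qed.

Lemma msize_mderiv i (p : S) k : (msz p <= k.+1)%N -> (msz (mderiv i p) <= k)%N.
Proof.
move=> pk; rewrite mmeasureE; apply/bigmax_leqP_seq => m.
rewrite mcoeff_msupp mcoeff_mderiv => h _.
rewrite -ltnS; apply: leq_trans pk.
have : (mnm_add m (mnm1 i)) \in msupp p.
  by rewrite mcoeff_msupp; apply: contra h => /eqP ->; rewrite mul0rn.
by move/msize_mdeg_lt; rewrite mdegD mdeg1 addn1.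
Qed.

Lemma msize_sym_inj x : (msz (sym_inj x) <= 2)%N.
Proof.
rewrite /sym_inj; elim/big_ind: _ => [|p q hp hq|i _]; first by rewrite mmeasure0.
  by apply: leq_trans (msizeD_le _ _) _; rewrite geq_max hp.
by apply: leq_trans (msizeZ_le _ _) _; rewrite msizeX mdeg1.
Qed.

(** A derivative lowers the degree by one and the linear factor restores it. Thus S(g) is a union of
    finite-dimensional representations. *)
Lemma msize_ham x (p : S) k : (msz p <= k)%N -> (msz (ham x p) <= k)%N.
Proof.
case: k => [|k] pk.
  move: pk; rewrite leqn0 mmeasure_poly_eq0 => /eqP ->.
  by rewrite (lin_map0 (ham_lin x)) mmeasure0.
rewrite hamE; elim/big_ind: _ => [|q r hq hr|i _]; first by rewrite mmeasure0.
  by apply: leq_trans (msizeD_le _ _) _; rewrite geq_max hq.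
set q := mderiv i p; set l := sym_inj _.
have [->|q0] := eqVneq q 0; first by rewrite mul0r mmeasure0.
have [->|l0] := eqVneq l 0; first by rewrite mulr0 mmeasure0.
rewrite msizeM // -ltnS prednK ?addn_gt0 ?lt0n ?mmeasure_poly_eq0 ?q0 //.
by have := leq_add (msize_mderiv i pk) (msize_sym_inj (br x (E i))); rewrite addn2.
Qed.

End PoissonAlgebra.

(** * Polynomials of bounded degree as a matrix representation of g *)

Section BoundedPolynomials.
Context {R : realType} {g : vectType R} {br : g -> g -> g}.
Hypothesis Hlie : is_lie_bracket br.
Local Notation n0 := (\dim {: g}).
Local Notation S := (sym_alg (g := g)).
Local Notation E i := (vbasis {: g})`_i.
Local Notation msz := (mmeasure (@mdeg n0)).

Section Rows.
Variable k : nat.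
Local Notation m := #|{: bmultinom n0 k}|.

Definition poly_of_row (v : 'rV[R]_m) : S :=
  \sum_i v 0 i *: mpolyX R (bmnm (enum_val i)).

Definition row_of_poly (p : S) : 'rV[R]_m := \row_i mcoeff (bmnm (enum_val i)) p.

Lemma poly_of_row_lin : linear poly_of_row.
Proof.
move=> a u v; rewrite /poly_of_row scaler_sumr -big_split; apply: eq_bigr => i _ /=.
by rewrite !mxE scalerDl scalerA.
Qed.

Lemma row_of_poly_lin : linear row_of_poly.
Proof. by move=> a p q; apply/rowP => i; rewrite !mxE mcoeffD mcoeffZ. Qed.

Lemma poly_of_rowK : cancel poly_of_row row_of_poly.
Proof.
move=> v; apply/rowP => i; rewrite mxE /poly_of_row raddf_sum (bigD1 i) //= big1.
  by rewrite mcoeffZ mcoeffX eqxx mulr1 addr0.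
move=> j ji; rewrite mcoeffZ mcoeffX -(bmeqP (enum_val j) (enum_val i)).
by rewrite (inj_eq enum_val_inj) (negbTE ji) mulr0.
Qed.

Lemma row_of_polyK p : (msz p <= k)%N -> poly_of_row (row_of_poly p) = p.
Proof.
move=> pk; rewrite [RHS](mpolywE pk) (reindex (fun i : 'I_m => enum_val i)) /=; last first.
  exact/onW_bij/enum_val_bij.
by apply: eq_bigr => i _; rewrite mxE.
Qed.

Definition ham_mx (x : g) : 'M[R]_m :=
  \matrix_i row_of_poly (ham (br := br) x (mpolyX R (bmnm (enum_val i)))).

Lemma poly_of_row_ham v x :
  poly_of_row (v *m ham_mx x) = ham (br := br) x (poly_of_row v).
Proof.
have mk i : (msz (ham (br := br) x (mpolyX R (bmnm (enum_val i : bmultinom n0 k)))) <= k)%N.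
  by apply: (msize_ham Hlie); rewrite msizeX bmdeg.
rewrite mulmx_sum_row (lin_map_sum _ _ _ poly_of_row_lin).
rewrite /(poly_of_row v) (lin_map_sum _ _ _ (ham_lin x)); apply: eq_bigr => i _.
rewrite (lin_mapZ _ _ poly_of_row_lin) (lin_mapZ _ _ (ham_lin x)).
by rewrite rowK row_of_polyK.
Qed.

Lemma ham_mx_rep : is_rep (br := br) ham_mx.
Proof.
split=> [a x y|x y].
  apply/row_matrixP => i; rewrite linearP /= !rowK (hamDl Hlie) row_of_poly_lin.
  by [].
apply/row_matrixP => i; apply: (can_inj poly_of_rowK).
rewrite linearB (lin_mapB _ _ poly_of_row_lin) /= !row_mul !poly_of_row_ham.
rewrite !rowK !row_of_polyK ?(ham_br Hlie) //.
- by apply: (msize_ham Hlie); rewrite msizeX bmdeg.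
- by apply: (msize_ham Hlie); rewrite msizeX bmdeg.
by rewrite -(ham_br Hlie); apply: (msize_ham Hlie); rewrite msizeX bmdeg.
Qed.

End Rows.

Hypothesis ss : lie_semisimple br.

Lemma sym_decomposition (J : S -> Prop) p :
  J 0 -> (forall a p q, J p -> J q -> J (a *: p + q)) ->
  (forall x p, J p -> J (ham (br := br) x p)) -> J p ->
  exists p0 (w : 'I_n0 -> S), [/\ J p0, forall x, ham (br := br) x p0 = 0 &
    p = p0 + \sum_(i < n0) ham (br := br) (E i) (w i)].
Proof.
move=> J0 Jl Jham Jp.
have pk := leqnn (msz p).
have [dec _] := rep_decomposition Hlie ss (ham_mx_rep (msz p)).
have [||v0 [_ [Jv0 v0inv [w _ ->] vE]]] := dec (fun v => J (poly_of_row v)) (row_of_poly _ p).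
- split=> [|a u v hu hv|v x hv].
  + by rewrite (lin_map0 (@poly_of_row_lin _)).
  + by rewrite poly_of_row_lin; exact: Jl.
  + by rewrite poly_of_row_ham; exact: Jham.
- by rewrite row_of_polyK.
exists (poly_of_row v0), (fun i => poly_of_row (w i)); split=> //.
  move=> x; rewrite -poly_of_row_ham v0inv.
  exact: (lin_map0 (@poly_of_row_lin _)).
rewrite -[LHS](row_of_polyK pk) vE (lin_mapD _ _ (@poly_of_row_lin _)).
rewrite (lin_map_sum _ _ _ (@poly_of_row_lin _)); congr (_ + _).
by apply: eq_bigr => i _; rewrite poly_of_row_ham.
Qed.

Lemma invariant_ham_image0 p (w : 'I_n0 -> S) :
  (forall x, ham (br := br) x p = 0) ->
  p = \sum_(i < n0) ham (br := br) (E i) (w i) -> p = 0.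
Proof.
(* The w_i may have larger degree than p, so the representation must be taken large enough for all
   of them. *)
move=> pinv pE; pose k := maxn (msz p) (\max_i msz (w i)).
have pk : (msz p <= k)%N by rewrite leq_maxl.
have wk i : (msz (w i) <= k)%N by rewrite leq_max (leq_bigmax (F := fun i => msz (w i))) orbT.
have [_ dec] := rep_decomposition Hlie ss (ham_mx_rep k).
rewrite -(row_of_polyK pk) (dec (row_of_poly _ p)).
- exact: (lin_map0 (@poly_of_row_lin _)).
- move=> x; apply: (can_inj (@poly_of_rowK k)).
  by rewrite poly_of_row_ham row_of_polyK // pinv (lin_map0 (@poly_of_row_lin _)).
exists (fun i => row_of_poly _ (w i)) => //; apply: (can_inj (@poly_of_rowK k)).
rewrite row_of_polyK // (lin_map_sum _ _ _ (@poly_of_row_lin _)) {1}pE.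
by apply: eq_bigr => i _; rewrite poly_of_row_ham row_of_polyK.
Qed.

End BoundedPolynomials.

(** * The adjoint representation of a Lie group *)

Section Differentials.
Context {R : realType}.

(** Charts are arbitrary outside their domains, so formulas for maps read in charts hold only near
    the base point; this lemma transports differentials across such local equalities. *)
Lemma is_diff_near (V W : normedModType R) (f g df : V -> W) x :
  (\forall y \near x, f y = g y) -> is_diff x f df -> is_diff x g df.
Proof.
move=> fg [dfx <-].
have gE : g \o shift x = cst (g x) + 'd f x +o_ 0 id.
  apply/eqaddoP => e e0.
  have /eqaddoP/(_ e e0) fo := diff_locally dfx.
  have fgx : f x = g x := nbhs_singleton fg.
  have fg0 : \forall y \near (0 : V), f (y + x) = g (y + x).
    by move: fg; rewrite (near_shift 0) subr0.
  by apply: filterS2 fo fg0 => y /= + fgy; rewrite /= !fctE /= fgx fgy.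
have dg : 'd g x = 'd f x :> (V -> W) by apply: diff_unique => //; exact: diff_continuous.
apply: DiffDef => //; apply/diff_locallyP; rewrite dg.
by split=> //; exact: diff_continuous.
Qed.

Lemma differentiable_near (V W : normedModType R) (f g : V -> W) x :
  (\forall y \near x, f y = g y) -> differentiable f x -> differentiable g x.
Proof. by move=> fg /differentiableP dfx; have [] := is_diff_near fg dfx. Qed.

End Differentials.

Section TangentAd.
Context {R : realType} {n : nat} {G : groupTopologicalType}.
Variables (A : set (chart 'rV[R]_n G)) (c : chart 'rV[R]_n G).
Hypothesis (HG : lie_group A) (Ac : A c) (c1 : cdom c 1%g).
Local Notation V := 'rV[R]_n.
Local Notation o := (cmap c 1%g).

Lemma chart_at a : exists2 d, A d & cdom d a.
Proof. exact: (atlas_cover (lie_group_atlas HG)). Qed.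

Lemma mulg_continuous_at (T : topologicalType) (f h : T -> G) x :
  {for x, continuous f} -> {for x, continuous h} ->
  {for x, continuous (fun y => f y * h y)%g}.
Proof.
move=> cf ch; have [cm _] := lie_group_mul HG.
apply: (@continuous_comp _ _ _ (fun y => (f y, h y)) (fun z => (z.1 * z.2)%g)).
  exact: cvg_pair.
exact: cm.
Qed.

Lemma near_cdom (T : topologicalType) (h : T -> G) x (d : chart V G) :
  {for x, continuous h} -> cdom d (h x) -> \forall y \near x, cdom d (h y).
Proof. by move=> ch dh; apply: ch; apply: open_nbhs_nbhs; split=> //; exact: cdom_open. Qed.

Lemma cinv_continuous_at (d : chart V G) a : cdom d a -> {for cmap d a, continuous (cinv d)}.
Proof. by move=> da; apply: cinv_cont; exists a. Qed.

Definition mul_chart (d e f : chart V G) (z : V * V) : V :=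
  cmap f (cinv d z.1 * cinv e z.2)%g.

(** Two orders of differentiability are extracted, because Ad, itself a first derivative of the
    product, must be differentiated once more. *)
Lemma mul_chart_smooth d e f a b : A d -> A e -> A f ->
  cdom d a -> cdom e b -> cdom f (a * b)%g ->
  differentiable (mul_chart d e f) (cmap d a, cmap e b) /\
  forall v, differentiable (fun z => 'd (mul_chart d e f) z v) (cmap d a, cmap e b).
Proof.
move=> Ad Ae Af da eb fab; have [_ sm] := lie_group_mul HG.
have /= := sm (chart_prod d e) f _ Af 2%N.
case; first by exists d, e.
have U : (cmap (chart_prod d e) @` (cdom (chart_prod d e) `&`
    (fun z : G * G => (z.1 * z.2)%g) @^-1` cdom f)) (cmap d a, cmap e b).
  by exists (a, b) => //=; split.
move=> d1 d2; split=> [|v]; first exact: d1.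
by have [h _] := d2 v; apply: h.
Qed.

Lemma inv_chart_diff d e a : A d -> A e -> cdom d a -> cdom e (a^-1)%g ->
  differentiable (fun x => cmap e (cinv d x)^-1%g) (cmap d a).
Proof.
move=> Ad Ae da ea; have [_ sm] := lie_group_inv HG.
have /= [h _] := sm d e Ad Ae 1%N; apply: h.
by exists a.
Qed.

Lemma mull_chart_diff e f a b : A e -> A f -> cdom e b -> cdom f (a * b)%g ->
  differentiable (fun x => cmap f (a * cinv e x)%g) (cmap e b).
Proof.
move=> Ae Af eb fab; have [d Ad da] := chart_at a.
have [dm _] := mul_chart_smooth Ad Ae Af da eb fab.
have -> : (fun x => cmap f (a * cinv e x)%g) = mul_chart d e f \o (fun x => (cmap d a, x)).
  by apply/funext => x; rewrite /mul_chart /= cmapK.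
by apply: differentiable_comp => //; apply: differentiable_pair.
Qed.

Lemma mulr_chart_diff e f a b : A e -> A f -> cdom e b -> cdom f (b * a)%g ->
  differentiable (fun x => cmap f (cinv e x * a)%g) (cmap e b).
Proof.
move=> Ae Af eb fab; have [d Ad da] := chart_at a.
have [dm _] := mul_chart_smooth Ae Ad Af eb da fab.
have -> : (fun x => cmap f (cinv e x * a)%g) = mul_chart e d f \o (fun x => (x, cmap d a)).
  by apply/funext => x; rewrite /mul_chart /= cmapK.
by apply: differentiable_comp => //; apply: differentiable_pair.
Qed.

Definition conj_chart (a : G) (x : V) : V := cmap c (a * cinv c x * a^-1)%g.

Lemma conj_chart_o a : conj_chart a o = o.
Proof. by rewrite /conj_chart cmapK // mulg1 mulgV. Qed.

Lemma conj_chart_cont a : {for o, continuous (fun x => a * cinv c x * a^-1)%g}.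
Proof.
apply: mulg_continuous_at; last exact: cst_continuous.
apply: mulg_continuous_at; first exact: cst_continuous.
exact: cinv_continuous_at.
Qed.

Lemma near_cdom_conj a : \forall x \near o, cdom c (a * cinv c x * a^-1)%g.
Proof.
apply: near_cdom; first exact: conj_chart_cont.
by rewrite cmapK // mulg1 mulgV.
Qed.

(** The intermediate point a x is near a, where c need not be a chart; a chart d at a factors
    conjugation into a left and a right translation. *)
Lemma conj_chart_diff a : differentiable (conj_chart a) o.
Proof.
have [d Ad da] := chart_at a.
have d1 : differentiable (fun x => cmap d (a * cinv c x)%g) o.
  by apply: mull_chart_diff; rewrite ?mulg1.
have d2 : differentiable (fun x => cmap c (cinv d x * a^-1)%g) (cmap d a).
  by apply: mulr_chart_diff; rewrite ?mulgV.
apply: (@differentiable_near _ _ _ ((fun x => cmap c (cinv d x * a^-1)%g) \o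
    (fun x => cmap d (a * cinv c x)%g))).
  have : \forall x \near o, cdom d (a * cinv c x)%g.
    apply: near_cdom; last by rewrite cmapK // mulg1.
    apply: mulg_continuous_at; first exact: cst_continuous.
    exact: cinv_continuous_at.
  by apply: filterS => x dx /=; rewrite cmapK.
have e : cmap d (a * cinv c o)%g = cmap d a by rewrite cmapK // mulg1.
by apply: (differentiable_comp d1); rewrite e.
Qed.

Lemma tangent_AdE a Y : tangent_Ad c a Y = 'd (conj_chart a) o Y.
Proof. by rewrite /tangent_Ad lfunE. Qed.

Lemma tangent_AdM a b : tangent_Ad c (a * b)%g = (tangent_Ad c a \o tangent_Ad c b)%VF.
Proof.
apply/lfunP => Y; rewrite comp_lfunE.
have E1 := tangent_AdE (a * b)%g Y; have E2 := tangent_AdE b Y.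
have E3 := tangent_AdE a (tangent_Ad c b Y).
apply: (etrans E1); apply: (etrans _ (esym (etrans E3 (congr1 ('d (conj_chart a) o) E2)))).
clear E1 E2 E3.
have da := conj_chart_diff a; have db := conj_chart_diff b.
have : is_diff o (conj_chart (a * b)%g) ('d (conj_chart a) o \o 'd (conj_chart b) o).
  apply: (@is_diff_near _ _ _ (conj_chart a \o conj_chart b)).
    have := near_cdom_conj b; apply: filterS => x cx.
    by rewrite /conj_chart /= cmapK // invgM !mulgA.
  have db' := differentiableP db.
  have da' : is_diff (conj_chart b o) (conj_chart a) ('d (conj_chart a) o).
    rewrite (conj_chart_o b).
    exact: differentiableP.
  exact: (is_diff_comp db' da').
by case=> _ /(congr1 (fun f => f Y)).
Qed.

Lemma near_cran (d : chart V G) a : cdom d a ->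
  \forall y \near cmap d a, cdom d (cinv d y) /\ cmap d (cinv d y) = y.
Proof.
move=> da; have : \forall y \near cmap d a, (cmap d @` cdom d) y.
  by apply: open_nbhs_nbhs; split; [exact: cran_open|exists a].
by apply: filterS => _ [x dx <-]; rewrite cmapK.
Qed.

Lemma tangent_Ad1 : tangent_Ad c 1%g = \1%VF.
Proof.
apply/lfunP => Y; rewrite id_lfunE; apply: (etrans (tangent_AdE _ _)).
suff : is_diff o (conj_chart 1%g) (fun v : V => v) by case=> _ /(congr1 (fun f => f Y)).
apply: (@is_diff_near _ _ _ (fun v : V => v)).
by have := near_cran c1; apply: filterS => y [_ cy]; rewrite /conj_chart invg1 mulg1 mul1g.
Qed.

(* In the chart, conjugation by cinv y is x |-> M(y, M(x, iota y)), with M the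
   product and iota the inverse. *)
Lemma tangent_Ad_diff Y : differentiable (fun y => tangent_Ad c (cinv c y) Y) o.
Proof.
pose M := mul_chart c c c; pose iota y := cmap c (cinv c y)^-1%g.
have c1i : cdom c (1^-1)%g by rewrite invg1.
have io : iota o = o by rewrite /iota cmapK // invg1.
have diota : differentiable iota o by apply: inv_chart_diff.
have ciota : {for o, continuous (fun y => (cinv c y)^-1)%g}.
  have [ci _] := lie_group_inv HG.
  apply: (@continuous_comp _ _ _ (cinv c) (fun a => a^-1)%g); last exact: ci.
  exact: cinv_continuous_at.
have [dM d2M] : differentiable M (o, o) /\
    forall v, differentiable (fun z => 'd M z v) (o, o).
  by apply: mul_chart_smooth; rewrite ?mulg1.
pose Z y := 'd M (o, iota y) (Y, 0).
have dZ : differentiable Z o.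
  apply: (@differentiable_comp _ _ _ _ (fun y => (o, iota y)) (fun z => 'd M z (Y, 0))).
    exact: differentiable_pair.
  by rewrite io; exact: d2M.
(* Smoothness makes z |-> 'd M z v differentiable for a fixed v only, whereas the outer differential
   is applied to the moving vector Z y. Expanding Z y in the standard basis leaves products of
   differentiable scalar functions. *)
pose H y i j := (Z y) 0 i * ('d M (y, iota y) (0, delta_mx 0 i)) 0 j.
have dH i j : differentiable (fun y => H y i j) o.
  have co (f : V -> V) k : differentiable f o -> differentiable (fun y => f y 0 k) o.
    move=> df; apply: (@differentiable_comp _ _ _ _ f (fun v => v 0 k)) => //.
    exact: differentiable_coord.
  apply: differentiableM; first exact: co.
  apply: (co (fun y => 'd M (y, iota y) (0, delta_mx 0 i))).
  apply: (@differentiable_comp _ _ _ _ (fun y => (y, iota y))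
    (fun z => 'd M z (0, delta_mx 0 i))); first exact: differentiable_pair.
  by rewrite io; exact: d2M.
apply: (@differentiable_near _ _ _
    (\sum_(i < n) \sum_(j < n) (fun y => H y i j *: (delta_mx 0 j : V)))); last first.
  apply: differentiable_sum => i; apply: differentiable_sum => j.
  exact: differentiableZl.
have nia : \forall y \near o, cdom c (cinv c y)^-1%g.
  by apply: near_cdom => //; rewrite cmapK.
have := near_cran c1; apply: filterS2 nia => y cy' [cy cyK].
rewrite fct_sumE.
transitivity (\sum_(i < n) (Z y) 0 i *: 'd M (y, iota y) (0, delta_mx 0 i)).
  apply: eq_bigr => i _; rewrite fct_sumE.
  rewrite [X in _ = _ *: X]row_sum_delta scaler_sumr; apply: eq_bigr => j _.
  by rewrite scalerA.
set a := cinv c y in cy cyK cy' *.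
have dM1 : differentiable M (o, iota y).
  by have [] := @mul_chart_smooth c c c 1%g (a^-1)%g; rewrite ?mul1g.
have dM2 : differentiable M (y, iota y).
  by have [] := @mul_chart_smooth c c c a (a^-1)%g; rewrite ?mulgV // /M cyK.
apply: (etrans _ (esym (tangent_AdE _ _))).
have Mo : M (o, iota y) = iota y by rewrite /M /mul_chart /= !cmapK // mul1g.
have : is_diff o (conj_chart a) (fun v => 'd M (y, iota y) (0, 'd M (o, iota y) (v, 0))).
  apply: (@is_diff_near _ _ _ ((fun x => M (y, x)) \o (fun x => M (x, iota y)))).
    have : \forall x \near o, cdom c (cinv c x * a^-1)%g.
      apply: near_cdom; last by rewrite cmapK // mul1g.
      apply: mulg_continuous_at; last exact: cst_continuous.
      exact: cinv_continuous_at.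
    apply: filterS => x cx; rewrite /conj_chart /M /mul_chart /= -/a.
    by rewrite (cmapK cy') cmapK // mulgA.
  have d1 : is_diff o (fun x => M (x, iota y)) (fun v => 'd M (o, iota y) (v, 0)).
    apply: (@is_diff_comp _ _ _ _ (fun x => (x, iota y)) (fun v => (v, 0)) M).
    exact: differentiableP.
  apply: (@is_diff_comp _ _ _ _ _ _ _ (fun w => 'd M (y, iota y) (0, w)) _ d1).
  rewrite Mo; apply: (@is_diff_comp _ _ _ _ (fun x => (y, x)) (fun v => (0, v)) M).
  exact: differentiableP.
case=> _ /(congr1 (fun f => f Y)) /esym; apply: etrans.
rewrite -[RHS]/('d M (y, iota y) (0, Z y)).
rewrite [X in 'd M (y, iota y) (0, X)]row_sum_delta.
have pE : (0, \sum_(j < n) (Z y) 0 j *: (delta_mx 0 j : V)) =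
    \sum_(j < n) (Z y) 0 j *: ((0, delta_mx 0 j) : V * V).
  rewrite [RHS]surjective_pairing; congr (_, _).
    by rewrite (raddf_sum (@fst V V)) big1 // => j _ /=; rewrite scaler0.
  by rewrite (raddf_sum (@snd V V)).
rewrite pE linear_sum; apply: eq_bigr => j _.
by rewrite linearZ.
Qed.

End TangentAd.

(** * Polynomials on a coadjoint orbit *)

Section Calculus.
Context {R : realType}.

Lemma is_diff_meval (V : normedModType R) n (f df : 'I_n -> V -> R) x (p : mpoly n R) :
  (forall i, is_diff x (f i) (df i)) ->
  is_diff x (fun y => meval (fun i => f i y) p)
    (fun v => \sum_i meval (fun i => f i x) (mderiv i p) * df i v).
Proof.
move=> Hf; pose P q := is_diff x (fun y => meval (fun i => f i y) q)
    (fun v => \sum_i meval (fun i => f i x) (mderiv i q) * df i v).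
have Pc a : P (mpolyC n a).
  rewrite /P (_ : (fun y => _) = cst a); last by apply/funext => y; rewrite mevalC.
  apply: (is_diff_eq (is_diff_cst a x)); apply/funext => v.
  by rewrite big1 // => i _; rewrite mderivC meval0 mul0r.
have PX i : P (mpolyX R (mnm1 i)).
  rewrite /P (_ : (fun y => _) = f i); last by apply/funext => y; rewrite mevalXU.
  apply: (is_diff_eq (Hf i)); apply/funext => v.
  rewrite (bigD1 i) //= big1 => [|j ji].
    rewrite mderivX mnm1E eqxx scale1r.
    have -> : mnm_sub (mnm1 i) (mnm1 i) = mnm0 by apply/mnmP=> k; rewrite mnmBE subnn mnm0E.
    by rewrite mpolyX0 meval1 mul1r addr0.
  by rewrite mderivX mnm1E eq_sym (negbTE ji) scale0r meval0 mul0r.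
have PD q r : P q -> P r -> P (q + r).
  move=> Pq Pr; rewrite /P (_ : (fun y => _) =
    (fun y => meval (fun i => f i y) q) + (fun y => meval (fun i => f i y) r)).
    apply: (is_diff_eq (is_diffD Pq Pr)); apply/funext => v.
    rewrite -[LHS]/(_ + _) -big_split; apply: eq_bigr => i _.
    by rewrite mderivD mevalD mulrDl.
  by apply/funext => y; rewrite mevalD.
have PM q r : P q -> P r -> P (q * r).
  move=> Pq Pr; rewrite /P (_ : (fun y => _) =
    (fun y => meval (fun i => f i y) q) * (fun y => meval (fun i => f i y) r)).
    apply: (is_diff_eq (is_diffM Pq Pr)); apply/funext => v.
    rewrite -[LHS]/(_ *: _ + _ *: _) !scaler_sumr -big_split; apply: eq_bigr => i _ /=.
    rewrite mderivM mevalD !mevalM -[LHS]/(_ * (_ * _) + _ * (_ * _)).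
    by ring.
  by apply/funext => y; rewrite mevalM.
have P1 : P 1 by exact: (Pc 1).
have Pe q k : P q -> P (q ^+ k).
  by move=> Pq; elim: k => [|k IH]; rewrite ?expr0 // exprS; exact: PM.
elim/mpolyind: p => [|a m q _ _ Pq]; first by rewrite -mpolyC0; exact: Pc.
apply: PD Pq; rewrite -mul_mpolyC; apply: (PM); first exact: Pc.
by rewrite mpolyXE_id; apply: (big_ind P P1 PM) => i _; exact: Pe.
Qed.

(** Mean value theorem on the segment from x to y, which stays in the ball. *)
Lemma constant_on_ball (V : normedModType R) (H : V -> R) x e y :
  (forall z, `|x - z| < e -> is_diff z H (fun=> 0)) -> `|x - y| < e -> H y = H x.
Proof.
move=> dH xy; pose l (t : R) : V := x + t *: (y - x).
have lball (t : R) : t \in `[0, 1] -> `|x - l t| < e.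
  move=> /[!in_itv] /= /andP[t0 t1].
  apply: le_lt_trans xy; rewrite /l opprD addrA subrr add0r normrN normrZ.
  by rewrite distrC ger0_norm // ler_piMl.
have dl (t : R) : is_diff t l (fun s => s *: (y - x)).
  have -> : l = cst x + (fun s => s *: (y - x)) by [].
  have h := is_diffD (is_diff_cst x t) (is_diff_scalel t (y - x)).
  by apply: (is_diff_eq h); rewrite add0r.
have dg (t : R) : t \in `[0, 1] -> is_diff t (H \o l) (fun=> 0).
  move=> t01; have dHt := dH _ (lball t t01).
  exact: (is_diff_comp (dl t) dHt).
have [||t _] := @MVT_segment R (H \o l) (fun=> 0) 0 1 ler01.
- move=> t t01; have [d dE] := dg t (subset_itv_oo_cc t01).
  apply: DeriveDef; first exact: diff_derivable.
  by rewrite deriveE // dE.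
- apply: continuous_in_subspaceT => t /[!inE] t01.
  by apply: differentiable_continuous; have [] := dg t t01.
rewrite mul0r /l /= scale1r scale0r addr0 [x + _]addrC subrK => /eqP.
by rewrite subr_eq0 => /eqP.
Qed.

End Calculus.

Section CoadjointOrbit.
Context {R : realType} {g : vectType R} {br : g -> g -> g}.
Context {n : nat} {G : groupTopologicalType}.
Variables (A : set (chart 'rV[R]_n G)) (c : chart 'rV[R]_n G).
Variable theta : 'Hom(g, 'rV[R]_n).
Hypotheses (Hlie : is_lie_bracket br) (HG : lie_group A).
Hypothesis iso : lie_algebra_iso br A c theta.
Local Notation V := 'rV[R]_n.
Local Notation o := (cmap c 1%g).
Local Notation E i := (vbasis {: g})`_i.

Let Ac : A c. Proof. exact: (lie_iso_chart iso). Qed.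
Let c1 : cdom c 1%g. Proof. exact: (lie_iso_chart1 iso). Qed.

Let thetaK : cancel theta (theta^-1)%VF.
Proof.
by apply/lker0_lfunK/lker0P; exact/bij_inj/(lie_iso_bij iso).
Qed.

Let thetaVK : cancel (theta^-1)%VF theta.
Proof. by have [k _ kK] := lie_iso_bij iso => v; rewrite -(kK v) thetaK. Qed.

Lemma conj_lfunM (S T : 'End(V)) :
  (theta^-1 \o (S \o T) \o theta)%VF =
  ((theta^-1 \o S \o theta) \o (theta^-1 \o T \o theta))%VF.
Proof. by apply/lfunP => x; rewrite !comp_lfunE thetaVK. Qed.

Lemma AdM a b : Ad c theta (a * b)%g = (Ad c theta a \o Ad c theta b)%VF.
Proof.
exact: (etrans (congr1 (fun T : 'End(V) => (theta^-1 \o T \o theta)%VF)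
  (tangent_AdM HG Ac c1 a b)) (conj_lfunM _ _)).
Qed.

Lemma Ad1 : Ad c theta 1%g = \1%VF.
Proof.
apply: (etrans (congr1 (fun T : 'End(V) => (theta^-1 \o T \o theta)%VF) (tangent_Ad1 c1))).
by apply/lfunP => x; rewrite !comp_lfunE !id_lfunE thetaK.
Qed.

Lemma coadjoint_orbit_Ad mu nu b : coadjoint_orbit c theta mu nu ->
  coadjoint_orbit c theta mu (nu \o Ad c theta b)%VF.
Proof.
(* [coAd] involves the inverse, so b^-1 a gives mu o Ad(a^-1 b) = (mu o Ad(a^-1)) o Ad(b). *)
move=> [a _ <-]; exists (b^-1 * a)%g; first by [].
rewrite /coAd invgM invgK.
exact: (etrans (congr1 (fun T => (mu \o T)%VF) (AdM _ _)) (comp_lfunA _ _ _)).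
Qed.

Lemma is_diff_lfun (f : 'Hom(V, R^o)) (w : V) :
  is_diff w (fun v => f v : R) (fun v => f v : R).
Proof.
have fE : (fun v => f v : R) = \sum_(j < n) (fun v : V => v 0 j *: (f (delta_mx 0 j) : R)).
  apply/funext => v; rewrite fct_sumE {1}[v]row_sum_delta linear_sum.
  by apply: eq_bigr => j _; rewrite linearZ.
have df x : differentiable (fun v => f v : R) x.
  rewrite fE; apply: differentiable_sum => j; apply: differentiableZl.
  exact: differentiable_coord.
have cf : continuous (fun v => f v : R).
  by move=> x; exact: differentiable_continuous.
apply: DiffDef => //.
exact: (@diff_lin R V R^o f w cf).
Qed.

(** The link between G and the Poisson bracket: by the definition of [tangent_bracket], the
    coordinates nu(Ad(y) e_i) have differential nu([x, e_i]) with x = theta^-1 v, and the chain rule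
    for p reproduces [hamE]. *)
Lemma is_diff_sym_eval_Ad (nu : 'Hom(g, R^o)) p :
  is_diff o (fun y => sym_eval (nu \o Ad c theta (cinv c y))%VF p)
    (fun v => sym_eval nu (ham (br := br) ((theta^-1)%VF v) p)).
Proof.
pose f (i : 'I_(\dim {: g})) y : R := (nu \o Ad c theta (cinv c y))%VF (E i).
pose df (i : 'I_(\dim {: g})) v : R := nu (br ((theta^-1)%VF v) (E i)).
have Hf i : is_diff o (f i) (df i).
  pose lam : 'Hom(V, R^o) := (nu \o theta^-1)%VF.
  pose k y := tangent_Ad c (cinv c y) (theta (E i)).
  have dk : is_diff o k ('d k o).
    by apply: differentiableP; exact: (tangent_Ad_diff HG Ac c1).
  have h := is_diff_comp dk (is_diff_lfun lam (k o)).
  have -> : f i = (fun v => lam v : R) \o k.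
    have compE (T : 'End(V)) x : (nu \o (theta^-1 \o T \o theta))%VF x = lam (T (theta x)).
      by rewrite !comp_lfunE.
    by apply/funext => y; exact: compE.
  apply: (is_diff_eq h); apply/funext => v.
  rewrite /df /= /lam comp_lfunE; congr (nu _).
  rewrite -[RHS]thetaK (lie_iso_bracket iso) thetaVK.
  by [].
have h := is_diff_meval p Hf; apply: (is_diff_eq h).
apply/funext => v; rewrite (hamE Hlie) /sym_eval raddf_sum; apply: eq_bigr => i _ /=.
rewrite mevalM; congr (_ * _); last by rewrite -[RHS]/(sym_eval nu _) sym_eval_inj.
apply: meval_eq => j; rewrite /f cmapK // Ad1 comp_lfunE id_lfunE.
by [].
Qed.

(** The orbit contains nu o Ad(a) for every a in G, so p vanishes along this family, and {x, p}(nu)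
    is its derivative at 1. *)
Lemma ham_vanishing_on_orbit mu x p :
  (forall nu, coadjoint_orbit c theta mu nu -> sym_eval nu p = 0) ->
  forall nu, coadjoint_orbit c theta mu nu -> sym_eval nu (ham (br := br) x p) = 0.
Proof.
move=> p0 nu Onu; have h := is_diff_sym_eval_Ad nu p.
have h0 : (fun y => sym_eval (nu \o Ad c theta (cinv c y))%VF p) = cst 0.
  by apply/funext => y; apply: p0; exact: coadjoint_orbit_Ad.
rewrite h0 in h; have [_ e] := h; have := congr1 (fun f => f (theta x)) e.
by rewrite diff_cst thetaK => <-.
Qed.

(** Left translates of the chart c cover G, and on a ball in each of them [ev] has zero
    differential. Hence [ev] is locally constant, its level sets are open and closed, and
    connectedness concludes. *)
Lemma constant_on_group (ev : G -> R) : connected [set: G] ->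
  (forall a a1, cdom c a1 ->
     is_diff (cmap c a1) (fun y => ev (a * cinv c y)%g) (fun=> 0)) ->
  forall a, ev a = ev 1%g.
Proof.
move=> Gconn ev_diff.
have ev_near a : \forall b \near a, ev b = ev a.
  have : \forall y \near o, (cmap c @` cdom c) y.
    by apply: open_nbhs_nbhs; split; [exact: cran_open|exists 1%g].
  move=> /nbhs_normP [e /= e0 be].
  have evo y : `|o - y| < e -> ev (a * cinv c y)%g = ev a.
    have dz z : `|o - z| < e -> is_diff z (fun y => ev (a * cinv c y)%g) (fun=> 0).
      by move=> oz; have [a1 ca1 <-] := be z oz; exact: ev_diff.
    move=> oy; apply: (etrans (constant_on_ball dz oy)).
    by apply: (congr1 ev); rewrite cmapK // mulg1.
  have cont : {for a, continuous (fun b => a^-1 * b)%g}.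
    by apply: (mulg_continuous_at HG); [exact: cst_continuous|move=> ?].
  have n1 : \forall b \near a, cdom c (a^-1 * b)%g.
    by apply: near_cdom => //; rewrite mulVg.
  have n2 : \forall b \near a, `|o - cmap c (a^-1 * b)%g| < e.
    have cc : {for a, continuous (fun b => cmap c (a^-1 * b)%g)}.
      apply: (@continuous_comp _ _ _ (fun b => a^-1 * b)%g (cmap c)) => //.
      by apply: cmap_cont; rewrite mulVg.
    apply: (cc [set w | `|o - w| < e]); rewrite mulVg.
    have n0 : \forall w \near o, `|o - w| < e by apply/nbhs_normP; exists e.
    exact: n0.
  apply: filterS2 n1 n2 => b cb ob.
  apply: (etrans _ (evo _ ob)); apply: (congr1 ev).
  by rewrite cmapK // mulgA mulgV mul1g.
have open_level (P : R -> Prop) : open [set a | P (ev a)].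
  rewrite openE => a Pa; have := ev_near a; apply: filterS => b /= ->.
  exact: Pa.
have : [set a | ev a = ev 1%g] = [set: G].
  apply: Gconn; first by exists 1%g.
    exists [set a | ev a = ev 1%g]; last by rewrite setTI.
    exact: (open_level (fun r => r = ev 1%g)).
  exists [set a | ev a = ev 1%g]; last by rewrite setTI.
  by rewrite -openC; exact: (open_level (fun r => r <> ev 1%g)).
by move=> e a; have : [set: G] a by []; rewrite -e.
Qed.

Lemma invariant_constant_on_orbit mu p : connected [set: G] ->
  (forall x, ham (br := br) x p = 0) ->
  forall nu, coadjoint_orbit c theta mu nu -> sym_eval nu p = sym_eval mu p.
Proof.
move=> Gconn pinv; pose ev a := sym_eval (mu \o Ad c theta a)%VF p.
have ev_diff a a1 : cdom c a1 -> is_diff (cmap c a1) (fun y => ev (a * cinv c y)%g) (fun=> 0).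
  (* Writing a y = (a a1)(a1^-1 y) moves the base point a1 to 1, where the differential is known for
     the functional mu o Ad(a a1). *)
  move=> ca1; pose T y := cmap c (a1^-1 * cinv c y)%g.
  have dT : is_diff (cmap c a1) T ('d T (cmap c a1)).
    by apply: differentiableP; apply: (mull_chart_diff HG) => //; rewrite mulVg.
  have To : T (cmap c a1) = o by rewrite /T cmapK // mulVg.
  have dP := is_diff_sym_eval_Ad (mu \o Ad c theta (a * a1)%g)%VF p.
  rewrite -To in dP.
  have h := is_diff_comp dT dP.
  have {}h := is_diff_eq h.
  apply: (@is_diff_near _ _ _ _ _ _ _ _ (h _ _)).
    have : \forall y \near cmap c a1, cdom c (a1^-1 * cinv c y)%g.
      apply: near_cdom; last by rewrite cmapK // mulVg.
      apply: (mulg_continuous_at HG); first exact: cst_continuous.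
      exact: cinv_continuous_at.
    apply: filterS => y cy; apply: (congr1 (fun h => sym_eval h p)).
    have e : cinv c (T y) = (a1^-1 * cinv c y)%g := cmapK cy.
    apply: (etrans (congr1 (fun b => (mu \o Ad c theta (a * a1)%g \o Ad c theta b)%VF) e)).
    apply: (etrans (esym (comp_lfunA _ _ _))).
    apply: (congr1 (fun T => (mu \o T)%VF)); apply: (etrans (esym (AdM _ _))).
    by rewrite -mulgA [(a1 * _)%g]mulgA mulgV mul1g.
  by apply/funext => v /=; rewrite pinv /sym_eval meval0.
have evE a : ev a = ev 1%g by exact: (constant_on_group (ev := ev)).
move=> _ [a _ <-]; apply: (etrans (evE _)); apply: (congr1 (fun h => sym_eval h p)).
apply: (etrans (congr1 (fun T => (mu \o T)%VF) Ad1)).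
by apply/lfunP => x; rewrite comp_lfunE id_lfunE.
Qed.

End CoadjointOrbit.

(** * Restriction to the orbit *)

Section Restriction.
Context {R : realType} {g : vectType R} {br : g -> g -> g}.
Hypothesis Hlie : is_lie_bracket br.
Variable O : set 'Hom(g, R^o).
Local Notation E i := (vbasis {: g})`_i.

Lemma sym_restr_lin : linear (sym_restr O).
Proof.
move=> a p q; apply/funext => nu; rewrite /sym_restr /sym_eval mevalD mevalZ.
by [].
Qed.

Lemma derived_idealE f : derived_ideal br O f <->
  exists w : 'I_(\dim {: g}) -> sym_alg (g := g),
    f = sym_restr O (\sum_(i < \dim {: g}) ham (br := br) (E i) (w i)).
Proof.
have resZ := lin_mapZ _ _ sym_restr_lin.
have resS := lin_map_sum _ _ _ sym_restr_lin.
split=> [[m [a [x [Hx ->]]]]|[w ->]].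
  elim/big_ind: _ => [|u v [wu ->] [wv ->]|i _].
  - exists (fun=> 0); rewrite big1 => [|i _]; last exact: lin_map0 (ham_lin _).
    by rewrite (lin_map0 sym_restr_lin).
  - exists (fun i => wu i + wv i); rewrite -(lin_mapD _ _ sym_restr_lin) -big_split.
    congr sym_restr; apply: eq_bigr => i _.
    by rewrite (lin_mapD _ _ (ham_lin _)).
  have [f1 [f2 [_ _ [p [q [_ _ ->]]]]]] := Hx i.
  exists (fun j => a i *: (mderiv j p * q)).
  rewrite (lie_poisson_ham Hlie) -resZ scaler_sumr; congr sym_restr.
  by apply: eq_bigr => j _; rewrite (lin_mapZ _ _ (ham_lin _)).
exists (\dim {: g}), (fun=> 1),
  (fun i : 'I_(\dim {: g}) => sym_restr O (ham (br := br) (E i) (w i))).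
split=> [i|]; last by rewrite resS; apply: eq_bigr => i _; rewrite scale1r.
exists (sym_restr O (sym_inj (E i))), (sym_restr O (w i)).
by split; [exists (sym_inj (E i))|exists (w i)|exists (sym_inj (E i)), (w i)].
Qed.

Lemma sym_restr_const a : sym_restr O (mpolyC _ a) = cst a.
Proof. by apply/funext => nu; rewrite /sym_restr /sym_eval mevalC. Qed.

End Restriction.

Theorem theorem2 (R : realType) (g : vectType R) (br : g -> g -> g)
    (n : nat) (G : groupTopologicalType) (A : set (chart 'rV[R]_n G))
    (c : chart 'rV[R]_n G) (theta : 'Hom(g, 'rV[R]_n))
    (O : set 'Hom(g, R^o)) :
  is_lie_bracket br ->
  lie_semisimple br ->
  lie_group A ->
  one_connected R G ->
  lie_algebra_iso br A c theta ->
  (exists mu : 'Hom(g, R^o), O = coadjoint_orbit c theta mu) ->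
  internal_direct_sum (poly_on O) (constants_on O) (derived_ideal br O).
Proof.
move=> Hlie ss HG [Gconn _] iso [mu OE].
have Omu : O mu.
  rewrite OE; exists 1%g; first by [].
  rewrite /coAd invg1; apply: (etrans (congr1 (fun T => (mu \o T)%VF) (Ad1 iso))).
  by apply/lfunP => x; rewrite comp_lfunE id_lfunE.
have stable x p : (forall nu, O nu -> sym_eval nu p = 0) ->
    forall nu, O nu -> sym_eval nu (ham (br := br) x p) = 0.
  by rewrite OE; exact: (ham_vanishing_on_orbit Hlie HG iso).
have const p : (forall x, ham (br := br) x p = 0) ->
    forall nu, O nu -> sym_eval nu p = sym_eval mu p.
  by move=> pinv; rewrite OE; exact: (invariant_constant_on_orbit Hlie HG iso).
clear OE; have resD := lin_mapD _ _ (@sym_restr_lin _ _ O).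
split; apply/seteqP; split.
- move=> _ [p _ <-].
  have [//|//|//|//|p0 [w [_ p0inv ->]]] := @sym_decomposition _ _ _ Hlie ss (fun=> True) p.
  exists (cst (sym_eval mu p0)); first by exists (sym_eval mu p0).
  exists (sym_restr O (\sum_(i < \dim {: g}) ham (br := br) (vbasis {: g})`_i (w i))).
    by apply/(derived_idealE Hlie); exists w.
  rewrite resD; congr (_ + _); apply/funext => -[nu Onu] /=.
  by rewrite /sym_restr /= (const p0) //; apply: set_mem.
- move=> _ [_ [a _ <-] [_ /(derived_idealE Hlie) [w ->] <-]].
  by rewrite -sym_restr_const -resD; eexists.
- move=> _ [[a _ <-] /(derived_idealE Hlie) [h hE]].
  set q := \sum_i _ in hE.
  pose J p := forall nu, O nu -> sym_eval nu p = 0.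
  have Jlin b p r : J p -> J r -> J (b *: p + r).
    move=> Jp Jr nu Onu; rewrite /sym_eval mevalD mevalZ -!/(sym_eval _ _).
    by rewrite Jp // Jr // mulr0 addr0.
  have Jr : J (mpolyC _ a - q).
    move=> nu Onu; have := congr1 (fun f => f (SigSub (mem_set Onu))) hE.
    rewrite /sym_restr /= => e; rewrite /sym_eval mevalB mevalC -/(sym_eval nu q).
    by rewrite -e subrr.
  have J0 : J 0 by move=> nu _; rewrite /sym_eval meval0.
  have [//|p0 [s [Jp0 p0inv rE]]] := sym_decomposition Hlie ss J0 Jlin _ Jr.
  (* Constants are invariant, hence so is a - p0; it also equals q plus the g.S(g) part of a - q.
     Being invariant and in g.S(g), it is zero, and p0 = a can be evaluated at the point mu of O. *)
  have p0E : mpolyC _ a - p0 = 0.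
    apply: (@invariant_ham_image0 _ _ _ Hlie ss _ (fun i => h i + s i)) => [x|].
      rewrite (lin_mapB _ _ (ham_lin x)) (ham_const Hlie) p0inv.
      by rewrite subrr.
    rewrite -[mpolyC _ a](subrK q) rE addrAC [p0 + _]addrC addrK addrC -big_split.
    by apply: eq_bigr => i _; rewrite (lin_mapD _ _ (ham_lin _)).
  have := Jp0 mu Omu; move/eqP: p0E; rewrite subr_eq0 => /eqP <-.
  by rewrite /sym_eval mevalC => ->.
- move=> _ ->; split; first by exists 0.
  apply/(derived_idealE Hlie); exists (fun=> 0); rewrite big1.
    by rewrite (lin_map0 (@sym_restr_lin _ _ O)).
  by move=> i _; rewrite (lin_map0 (ham_lin _)).
Qed.
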